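(* The recoverable spanning tree problem (\textsc{Rec ST}) can be solved (by a combinatorial algorithm) in $O(Lm^2n)$ time, where $L=n-1-k$.
   Context: Let $G=(V,E)$ be a connected undirected graph with $|V|=n$, $|E|=m$, and let $\Phi$ be the set of its spanning trees (as edge sets). Each edge $e$ has a first stage cost $C_e$ and a second stage cost $c_e$. For $X\in\Phi$ and an integer recovery parameter $k\in[0,n-1]$, let $\Phi^k_X=\{Y\in\Phi: |Y\setminus X|\le k\}$. \textsc{Rec ST} asks for $X\in\Phi$ and $Y\in\Phi^k_X$ attaining $\min_{X\in\Phi}\left(\sum_{e\in X}C_e+\min_{Y\in\Phi^k_X}\sum_{e\in Y}c_e\right)$. *)

(* Defs.v *)
From HB Require Import structures.
From mathcomp Require Import all_boot all_order all_algebra.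

Set Implicit Arguments.
Unset Strict Implicit.
Unset Printing Implicit Defensive.

Import Order.TTheory GRing.Theory Num.Theory.

Local Open Scope ring_scope.

                                  

                                                                              
                                                                             
                                                                              
                                       
Record graph := Graph {
  nv : nat;
  ne : nat;
  ends : 'I_ne -> 'I_nv * 'I_nv
}.

Definition adj (G : graph) (T : {set 'I_(ne G)}) : rel 'I_(nv G) :=
  fun u v => [exists e in T, (ends e == (u, v)) || (ends e == (v, u))].

Definition connected_by (G : graph) (T : {set 'I_(ne G)}) : Prop :=
  forall u v, connect (adj T) u v.

Definition connected_graph (G : graph) : Prop :=
  (0 < nv G)%N /\ connected_by [set: 'I_(ne G)].

                                                               
Definition dart (G : graph) : Type := ('I_(ne G) * bool)%type.

Definition dart_from (G : graph) (d : dart G) : 'I_(nv G) :=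
  if d.2 then (ends d.1).1 else (ends d.1).2.

Definition dart_to (G : graph) (d : dart G) : 'I_(nv G) :=
  if d.2 then (ends d.1).2 else (ends d.1).1.

                                                                               
                                                                              
                                              
Definition graph_cycle (G : graph) (s : seq (dart G)) : bool :=
  [&& s != [::], cycle (fun d d' => dart_to d == dart_from d') s,
      uniq (map fst s) & uniq (map (@dart_from G) s)].

Definition acyclic (G : graph) (T : {set 'I_(ne G)}) : Prop :=
  forall s : seq (dart G), graph_cycle s -> ~~ all (fun d => d.1 \in T) s.

Definition spanning_tree (G : graph) (T : {set 'I_(ne G)}) : Prop :=
  connected_by T /\ acyclic T.

                                              

Definition recovery_set (G : graph) (k : nat) (X Y : {set 'I_(ne G)}) : Prop :=
  spanning_tree Y /\ (#|Y :\: X| <= k)%N.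

Definition cost (R : realFieldType) (G : graph) (w : 'I_(ne G) -> R)
    (T : {set 'I_(ne G)}) : R :=
  \sum_(e in T) w e.

Definition is_min (R : realFieldType) (S : R -> Prop) (v : R) : Prop :=
  S v /\ forall w, S w -> v <= w.

Definition recovery_min (R : realFieldType) (G : graph) (c : 'I_(ne G) -> R)
    (k : nat) (X : {set 'I_(ne G)}) (v : R) : Prop :=
  is_min (fun w => exists2 Y, recovery_set k X Y & w = cost c Y) v.

Definition rec_st_min (R : realFieldType) (G : graph) (C c : 'I_(ne G) -> R)
    (k : nat) (v : R) : Prop :=
  is_min (fun w => exists X r, [/\ spanning_tree X, recovery_min c k X r
                                 & w = cost C X + r]) v.

Definition rec_st_solution (R : realFieldType) (G : graph)
    (C c : 'I_(ne G) -> R) (k : nat) (X Y : {set 'I_(ne G)}) : Prop :=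
  [/\ spanning_tree X, recovery_set k X Y
    & rec_st_min C c k (cost C X + cost c Y)].

                      

                                                                                
                                                                             
                                                                              
                                                                               
                                                                             
                                                                              
                                                  

Inductive iexp : Type :=
| INum of nat
| IGet of nat & iexp                              
| IAdd of iexp & iexp
| ISub of iexp & iexp.                                     

Inductive rexp : Type :=
| RGet of nat & iexp
| RAdd of rexp & rexp
| RSub of rexp & rexp.

Inductive bexp : Type :=
| BIle of iexp & iexp
| BRle of rexp & rexp
| BNot of bexp
| BAnd of bexp & bexp.

Inductive cmd : Type :=
| Skip
| ISet of nat & iexp & iexp                              
| RSet of nat & iexp & rexp
| Seq of cmd & cmd
| If of bexp & cmd & cmd
| While of bexp & cmd.

Record state (R : realFieldType) := State {
  imem : nat -> nat -> nat;
  rmem : nat -> nat -> R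
}.

Definition upd (T : Type) (f : nat -> nat -> T) (a i : nat) (v : T) :
    nat -> nat -> T :=
  fun a' i' => if (a' == a) && (i' == i) then v else f a' i'.

Fixpoint ieval (R : realFieldType) (s : state R) (e : iexp) : nat :=
  match e with
  | INum x => x
  | IGet a i => imem s a (ieval s i)
  | IAdd e1 e2 => (ieval s e1 + ieval s e2)%N
  | ISub e1 e2 => (ieval s e1 - ieval s e2)%N
  end.

Fixpoint reval (R : realFieldType) (s : state R) (e : rexp) : R :=
  match e with
  | RGet a i => rmem s a (ieval s i)
  | RAdd e1 e2 => reval s e1 + reval s e2
  | RSub e1 e2 => reval s e1 - reval s e2
  end.

Fixpoint beval (R : realFieldType) (s : state R) (b : bexp) : bool :=
  match b with
  | BIle e1 e2 => (ieval s e1 <= ieval s e2)%N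
  | BRle e1 e2 => reval s e1 <= reval s e2
  | BNot b1 => ~~ beval s b1
  | BAnd b1 b2 => beval s b1 && beval s b2
  end.

Fixpoint itime (e : iexp) : nat :=
  match e with
  | INum _ => 1
  | IGet _ i => (itime i).+1
  | IAdd e1 e2 | ISub e1 e2 => (itime e1 + itime e2).+1
  end.

Fixpoint rtime (e : rexp) : nat :=
  match e with
  | RGet _ i => (itime i).+1
  | RAdd e1 e2 | RSub e1 e2 => (rtime e1 + rtime e2).+1
  end.

Fixpoint btime (b : bexp) : nat :=
  match b with
  | BIle e1 e2 => (itime e1 + itime e2).+1
  | BRle e1 e2 => (rtime e1 + rtime e2).+1
  | BNot b1 => (btime b1).+1
  | BAnd b1 b2 => (btime b1 + btime b2).+1
  end.

                                                                                
                                                                              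
                         
Inductive exec (R : realFieldType) :
    cmd -> state R -> nat -> state R -> Prop :=
| exec_skip s : exec Skip s 1 s
| exec_iset a i e s :
    exec (ISet a i e) s (itime i + itime e).+1
      (State (upd (imem s) a (ieval s i) (ieval s e)) (rmem s))
| exec_rset a i e s :
    exec (RSet a i e) s (itime i + rtime e).+1
      (State (imem s) (upd (rmem s) a (ieval s i) (reval s e)))
| exec_seq p q s t s' t' s'' :
    exec p s t s' -> exec q s' t' s'' -> exec (Seq p q) s (t + t') s''
| exec_if b p q s t s' :
    exec (if beval s b then p else q) s t s' ->
    exec (If b p q) s (btime b + t).+1 s'
| exec_while_done b p s :
    ~~ beval s b -> exec (While b p) s (btime b).+1 s
| exec_while_step b p s t s' t' s'' :
    beval s b -> exec p s t s' -> exec (While b p) s' t' s'' ->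
    exec (While b p) s (btime b + t + t').+1 s''.

                         

Definition table (T : Type) (m : nat) (dflt : T) (f : 'I_m -> T) (i : nat) : T :=
  oapp f dflt (insub i).

                                                                              
                                                                                
                           
Definition input (R : realFieldType) (G : graph) (C c : 'I_(ne G) -> R)
    (k : nat) : state R :=
  State
    (fun a => match a with
              | 0%N => nth 0%N [:: nv G; ne G; k]
              | 1%N => table 0%N (fun e => val (@ends G e).1)
              | 2%N => table 0%N (fun e => val (@ends G e).2)
              | _ => fun=> 0%N
              end)
    (fun a => match a with
              | 0%N => table 0 C
              | 1%N => table 0 c
              | _ => fun=> 0
              end).

                                                                         
            
Definition output (R : realFieldType) (G : graph) (s : state R) (a : nat) :
    {set 'I_(ne G)} :=
  [set e | imem s a (val e) != 0%N].

Definition output_X (R : realFieldType) (G : graph) (s : state R) :=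
  output G s 3.
Definition output_Y (R : realFieldType) (G : graph) (s : state R) :=
  output G s 4.

(* Main.v *)
Require Import Defs.
From mathcomp Require Import all_boot all_order all_algebra.
From mathcomp Require Import ring lra zify.
From Stdlib Require Import FunctionalExtensionality.

(* Lagrangian duality.  Let al : E -> [0, th] be such that X is a minimum
   spanning tree for C - al, Y is one for c + al, al = 0 on X \ Y and al = th
   on Y \ X.  For spanning trees X', Y' with |Y' \ X'| <= k this gives
   C(X') + c(Y') >= C(X) + c(Y) + th (|Y \ X| - |Y' \ X'|), so (X, Y) is optimal
   if |Y \ X| = k, or if |Y \ X| <= k and th = 0.

   Start from minimum spanning trees for C and c (Prim), al = 0 and th = 0.
   While |Y \ X| > k, run a Hungarian search in the graph on E whose arcs u -> v
   are the exchanges "X - u + v is a tree" (length C v - C u) and "Y - v + u is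
   a tree" (length c u - c v); al is a potential for these lengths.  The search
   grows a set from the sources X \ Y by arcs of minimum slack, raising al
   outside the set, until it meets a sink in Y \ X.  Each node takes as parent
   the earliest node with a tight arc to it, so the path found has no tight
   shortcut, and all its exchanges can be carried out simultaneously; this
   lowers |Y \ X| by one.  An exchange between a source and a sink always exists
   by the symmetric exchange property, so no search fails.  Since
   |Y| = n - 1 there are at most n - 1 - k searches, each of cost O(m^2 n). *)

Set Implicit Arguments.
Unset Strict Implicit.
Unset Printing Implicit Defensive.

Import Order.TTheory GRing.Theory Num.Theory.

(** * Connectivity and spanning trees *)

(** The bound O(m^2 n) for one phase comes from deciding which exchanges exist: for every edge u,
    Prim's algorithm is run on the tree without u, at O(mn) each. The rest of a phase is O(m^2), so
    plain array scans suffice. The obstacle is that each swap along the path changes the exchange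
    graph for the remaining ones. The remedy is to work in the family of minimum trees for the
    reduced costs instead of all trees: it satisfies symmetric exchange, and its swaps are exactly
    the tight arcs. In any exchange family, the swap u -> v preserves both presence and absence of
    an arc a -> b as long as there is no arc a -> v. When the path is walked back from the sink,
    this asks only that no node behind the parent of v has a tight arc into v. Complementing Y
    reverses its arcs, so the same two lemmas serve both trees. The clauses on al survive a raise
    for two reasons: a source outside the search set has key 0 and forces a raise by 0, and a sink
    is always outside, so it rises together with th. *)

Section Connectivity.

Variable G : graph.
Implicit Types (T : {set 'I_(ne G)}) (e f g : 'I_(ne G)) (x y : 'I_(nv G)).

Lemma adj_csym T : connect_sym (adj T).
Proof.
apply: sym_connect_sym => x y; apply: eq_existsb => e.
by rewrite orbC.
Qed.

(** Connection as an equation between canonical representatives, so that chains of connections close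
    by rewriting or [congruence]. *)
Lemma connP T x y :
  reflect (fingraph.root (adj T) x = fingraph.root (adj T) y) (connect (adj T) x y).
Proof. by rewrite -(root_connect (adj_csym T)); apply: eqP. Qed.

Lemma adj_edge T e : e \in T -> adj T (ends e).1 (ends e).2.
Proof.
by move=> eT; apply/existsP; exists e; rewrite eT -surjective_pairing eqxx.
Qed.

Lemma connect_edge T e : e \in T -> connect (adj T) (ends e).1 (ends e).2.
Proof. by move=> eT; apply/connect1/adj_edge. Qed.

Lemma connect_subset T T' :
  T \subset T' -> subrel (connect (adj T)) (connect (adj T')).
Proof.
move=> /subsetP sTT'; apply: connect_sub => x y /existsP[e /andP[eT exy]].
by apply/connect1/existsP; exists e; rewrite sTT'.
Qed.

Lemma connect_cut T (A : pred 'I_(nv G)) x y :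
  connect (adj T) x y -> A x -> ~~ A y ->
  exists2 e, e \in T & A (ends e).1 != A (ends e).2.
Proof.
move=> xy Ax Ay; apply/exists_inP; apply: contraNT Ay.
rewrite negb_exists => /forallP h; suff clA : closed (adj T) A.
  by rewrite -[A y]/(y \in A) -(closed_connect clA xy).
move=> u v /existsP[e /andP[eT exy]].
have := h e; rewrite eT /= negbK -[A _ == A _]/((_ \in A) == (_ \in A)) => /eqP.
by case/orP: exy => /eqP -> /=.
Qed.

(** No path is decomposed: the disjunction, as a predicate [A] of the second endpoint, is crossed by
    no edge of [f |: T], and [connect_cut] concludes. *)
Lemma connect_add T f x y : connect (adj (f |: T)) x y ->
  [|| connect (adj T) x y,
      connect (adj T) x (ends f).1 && connect (adj T) (ends f).2 y
    | connect (adj T) x (ends f).2 && connect (adj T) (ends f).1 y].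
Proof.
pose A y := [|| connect (adj T) x y,
      connect (adj T) x (ends f).1 && connect (adj T) (ends f).2 y
    | connect (adj T) x (ends f).2 && connect (adj T) (ends f).1 y].
rewrite -/(A y) => xy.
have Ax : A x by rewrite /A connect0.
apply: contraT => nAy; have [e] := connect_cut xy Ax nAy.
rewrite in_setU1 => /orP[/eqP->|eT]; last first.
  have ce z := same_connect_r (@adj_csym T) (connect_edge eT) z.
  by rewrite /A !ce eqxx.
rewrite /A !connect0 !andbT.
by do !case: (connect _ x _) => //=; rewrite ?orbT.
Qed.

(** Acyclicity is replaced by the condition that every edge is a bridge, the form that exchange
    arguments use. *)
Definition is_tree T : bool :=
  [forall x, forall y, connect (adj T) x y] &&
  [forall e in T, ~~ connect (adj (T :\ e)) (ends e).1 (ends e).2].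

Lemma is_treeP T : reflect
  ((forall x y, connect (adj T) x y) /\
   (forall e, e \in T -> ~~ connect (adj (T :\ e)) (ends e).1 (ends e).2))
  (is_tree T).
Proof.
apply: (iffP andP) => -[c b]; split.
- by move=> x y; move/forallP: c => /(_ x)/forallP.
- by move/forall_inP: b.
- by apply/forallP => x; apply/forallP.
- by apply/forall_inP.
Qed.


Lemma dart_ends T (d : dart G) : d.1 \in T ->
  connect (adj T) (dart_from d) (dart_to d).
Proof.
move=> dT; rewrite /dart_from /dart_to; case: d.2; first exact: connect_edge.
by rewrite adj_csym connect_edge.
Qed.

Lemma path_darts T x p : path (adj T) x p -> uniq (x :: p) ->
  exists s : seq (dart G),
    [/\ all (fun d => d.1 \in T) s, map (@dart_from G) s = belast x p,
        map (@dart_to G) s = p & uniq (map fst s)].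
Proof.
elim: p x => [|y p IHp] x /=; first by exists [::].
move=> /andP[/existsP[e /andP[eT exy]] yp] /and3P[xp xy up].
have [|s [sT sf st us]] := IHp y yp; first by rewrite /= xy up.
exists ((e, ends e == (x, y)) :: s); rewrite /= eT sT sf st us andbT.
have ef : dart_from (e, ends e == (x, y)) = x /\
          dart_to (e, ends e == (x, y)) = y.
  rewrite /dart_from /dart_to /=; case: eqP exy => [->//|_ /eqP->//].
rewrite ef.1 ef.2; split=> //; rewrite andbT.
apply: contra xp => /mapP[d ds /= ed].
have df : dart_from d \in y :: p.
  by apply: mem_belast; rewrite -sf map_f.
have dt : dart_to d \in y :: p by rewrite in_cons -st map_f ?orbT.
have: ((x == dart_from d) || (x == dart_to d)).
  move: exy; rewrite ed /dart_from /dart_to.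
  by case: d.2 => /orP[] /eqP-> /=; rewrite eqxx ?orbT.
by case/orP => /eqP->.
Qed.

Lemma darts_path (d0 d : dart G) (s : seq (dart G)) x p :
  dart_to d = x -> map (@dart_from G) s = belast x p ->
  map (@dart_to G) s = p -> dart_from d0 = last x p ->
  path (fun d d' => dart_to d == dart_from d') d (rcons s d0).
Proof.
elim: s d x p => [|d1 s IHs] d x [|y p] //= dx; first by rewrite dx andbT => _ _ ->.
by move=> [d1x sf] [d1y st] d0l; rewrite dx d1x eqxx (IHs _ y p).
Qed.

Lemma darts_connect T (d0 d : dart G) (s : seq (dart G)) :
  path (fun d d' => dart_to d == dart_from d') d (rcons s d0) ->
  all (fun d => d.1 \in T) s -> connect (adj T) (dart_to d) (dart_from d0).
Proof.
elim: s d => [|d1 s IHs] d /=; first by move=> /andP[/eqP->].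
move=> /andP[/eqP-> ps] /andP[d1T /(IHs _ ps)]; apply: connect_trans.
exact: dart_ends.
Qed.

(** A simple path joining the ends of [e] in [T :\ e] closes up with [e] into a cycle. Conversely, a
    cycle without its first dart joins the ends of that edge, and avoids it because the edges of a
    cycle are distinct. *)
Lemma spanning_treeP T : spanning_tree T <-> is_tree T.
Proof.
split=> [[cT aT]|/is_treeP[cT bT]].
  apply/is_treeP; split=> // e eT; apply/negP => /connectP[p ep].
  case/shortenP: ep => {}p ep up _ elast.
  have [s [sT sf st us]] := path_darts ep up.
  have /aT : graph_cycle ((e, false) :: s).
    rewrite /graph_cycle /= us sf {2}/dart_from /= andbC.
    move: up; rewrite lastI rcons_uniq -elast => /andP[-> ->] /=.
    have -> /= : e \notin map fst s.
      apply/mapP => -[d ds ed]; move/allP/(_ d ds): sT.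
      by rewrite -ed !inE eqxx.
    exact: (darts_path (x := (ends e).1) (p := p)).
  rewrite /= eT /= => /negP; apply; apply: sub_all sT => d.
  by rewrite inE => /andP[].
split=> // s /and4P[]; case: s => // d s _ cyc /andP[ds us] _.
apply/negP => /= /andP[dT sT]; have /negP := bT _ dT; apply.
have sT' : all (fun d' => d'.1 \in T :\ d.1) s.
  apply/allP => d' d's; rewrite !inE (allP sT _ d's) andbT.
  by apply: contraNneq ds => <-; apply: map_f.
have := darts_connect cyc sT'.
by rewrite /dart_from /dart_to; case: d.2 => //; rewrite adj_csym.
Qed.

Lemma tree_swap T f e : is_tree T -> f \in T ->
  ~~ connect (adj (T :\ f)) (ends e).1 (ends e).2 -> is_tree (e |: T :\ f).
Proof.
move=> /is_treeP[cT bT] fT ef.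
have Tf : T = f |: T :\ f by rewrite setD1K.
have sub x y : connect (adj (T :\ f)) x y ->
    fingraph.root (adj (e |: T :\ f)) x = fingraph.root (adj (e |: T :\ f)) y.
  by move=> h; apply/connP; move: h; apply/connect_subset/subsetUr.
have ee : fingraph.root (adj (e |: T :\ f)) (ends e).1 = fingraph.root (adj (e |: T :\ f)) (ends e).2.
  by apply/connP/connect_edge; rewrite setU11.
have ff : fingraph.root (adj (e |: T :\ f)) (ends f).1 = fingraph.root (adj (e |: T :\ f)) (ends f).2.
  (* The connection in [T] between the ends of [e] must use [f], so each end of [f] is joined in
     [T :\ f] to an end of [e]. *)
  have := cT (ends e).1 (ends e).2; rewrite {1}Tf => /connect_add.
  by rewrite (negPf ef) /= => /orP[] /andP[/sub h1 /sub h2]; congruence.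
apply/is_treeP; split=> [x y|g].
  apply/connP; have := cT x y; rewrite {1}Tf.
  by case/connect_add/or3P => [/sub//||] /andP[/sub h1 /sub h2]; congruence.
have eTf : e \notin T :\ f by apply: contra ef; apply: connect_edge.
rewrite in_setU1 => /orP[/eqP->|gTf]; first by rewrite setU1K.
have gT : g \in T by move: gTf; rewrite !inE => /andP[].
have ge : g != e by apply: contraNneq eTf => <-.
have -> : (e |: T :\ f) :\ g = e |: (T :\ f :\ g).
  by apply/setP => z; rewrite !inE; case: (eqVneq z e) => //= ->; rewrite eq_sym ge.
have sub1 x y : connect (adj (T :\ f :\ g)) x y ->
    fingraph.root (adj (T :\ f)) x = fingraph.root (adj (T :\ f)) y.
  by move=> h; apply/connP; move: h; apply/connect_subset/subD1set.
have gg : fingraph.root (adj (T :\ f)) (ends g).1 = fingraph.root (adj (T :\ f)) (ends g).2.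
  exact/connP/connect_edge.
apply/negP => /connect_add/or3P[h||].
- have := bT g gT; rewrite (connect_subset _ h) //.
  by apply: setSD; apply: subD1set.
- by move=> /andP[/sub1 h1 /sub1 h2]; case/connP: ef; congruence.
- by move=> /andP[/sub1 h1 /sub1 h2]; case/connP: ef; congruence.
Qed.

(** A minimal subset [D] of [T] connecting [x] to [y] plays the role of the tree path. It leaves [A]
    through some [f]; if [x] and [y] were connected without [f], so would be the ends of [f],
    although [f] is a bridge. *)
Lemma tree_crossing T (A : pred 'I_(nv G)) x y : is_tree T -> A x -> ~~ A y ->
  exists f, [/\ f \in T, A (ends f).1 != A (ends f).2
              & ~~ connect (adj (T :\ f)) x y].
Proof.
move=> /is_treeP[cT bT] Ax Ay.
pose P (D : {set 'I_(ne G)}) := connect (adj D) x y.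
have [D /minsetP[/= PD minD] DT] := minset_exists (P := P) (cT x y).
have [f fD fA] := connect_cut PD Ax Ay.
have fT := subsetP DT f fD.
exists f; split=> //; apply: contra (bT f fT) => /connP xy; apply/connP.
have nD : ~~ connect (adj (D :\ f)) x y.
  apply/negP => /minD /(_ (subD1set _ _)) DD.
  by move: fD; rewrite -DD setD11.
have sub u v : connect (adj (D :\ f)) u v ->
    fingraph.root (adj (T :\ f)) u = fingraph.root (adj (T :\ f)) v.
  by move=> h; apply/connP; move: h; apply: connect_subset; apply: setSD.
have := PD; rewrite /P -(setD1K fD) => /connect_add; rewrite (negPf nD) /=.
by case/orP => /andP[/sub h1 /sub h2]; [rewrite -h1 xy -h2 | rewrite h2 -xy h1].
Qed.

(** Removing [e] splits [T1] into two sides; the path of [T2] between the ends of [e] changes sides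
    at some [f], which serves for both swaps. *)
Lemma tree_exchange T1 T2 e : is_tree T1 -> is_tree T2 -> e \in T1 :\: T2 ->
  exists2 f, f \in T2 :\: T1 &
    is_tree (f |: T1 :\ e) && is_tree (e |: T2 :\ f).
Proof.
move=> tT1 tT2; rewrite inE => /andP[eT2 eT1].
have /is_treeP[_ /(_ e eT1) be] := tT1.
have [f [fT2 fA fe]] := tree_crossing (A := connect (adj (T1 :\ e)) (ends e).1) tT2
   (connect0 _ _) be.
exists f; last first.
  rewrite !tree_swap //; apply: contra fA => /connP ff.
  rewrite -!(root_connect (@adj_csym (T1 :\ e))); apply/eqP; congruence.
rewrite inE fT2 andbT; apply: contra fA => fT1.
rewrite -!(root_connect (@adj_csym (T1 :\ e))).
suff -> : fingraph.root (adj (T1 :\ e)) (ends f).1 = fingraph.root (adj (T1 :\ e)) (ends f).2 by [].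
apply/connP/connect_edge; rewrite !inE fT1 andbT.
by apply: contraNneq eT2 => <-.
Qed.

Lemma tree_swapE T f e : is_tree T -> f \in T -> e \notin T ->
  is_tree (e |: T :\ f) = ~~ connect (adj (T :\ f)) (ends e).1 (ends e).2.
Proof.
move=> tT fT eT; apply/idP/idP; last exact: tree_swap.
move=> /is_treeP[_ /(_ e)]; rewrite setU11 setU1K; first by apply.
by rewrite !inE negb_and eT orbT.
Qed.

(** [T :\ f] has two components, so marking the one of [(ends f).1] decides the swap; this is the
    test made by the program. *)
Lemma tree_swap_mark T f e : is_tree T -> f \in T -> e \notin T ->
  is_tree (e |: T :\ f) =
  (connect (adj (T :\ f)) (ends f).1 (ends e).1 !=
   connect (adj (T :\ f)) (ends f).1 (ends e).2).
Proof.
move=> tT fT eT; rewrite tree_swapE // -!(root_connect (@adj_csym (T :\ f))).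
have h x : fingraph.root (adj (T :\ f)) x = fingraph.root (adj (T :\ f)) (ends f).1 \/
           fingraph.root (adj (T :\ f)) x = fingraph.root (adj (T :\ f)) (ends f).2.
  have /is_treeP[/(_ x (ends f).1) + _] := tT.
  rewrite -{1}(setD1K fT) => /connect_add/or3P[/connP||].
  - by move=> h; left.
  - by case/andP => /connP h _; left.
  - by case/andP => /connP h _; right.
have /is_treeP[_ /(_ f fT)] := tT; rewrite -(root_connect (@adj_csym _)).
move: (fingraph.root _ (ends f).1) (fingraph.root _ (ends f).2) h => a b h nab.
by case: (h (ends e).1) (h (ends e).2) => -> [] ->;
  rewrite ?[b == a]eq_sym ?eqxx ?(negPf nab).
Qed.

Lemma tree_exists : connected_graph G -> exists T, is_tree T.
Proof.
case=> _ cG.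
pose P (D : {set 'I_(ne G)}) := [forall x, forall y, connect (adj D) x y].
have PT : P setT by apply/forallP => x; apply/forallP => y; apply: cG.
have [D /minsetP[/= PD minD] _] := minset_exists PT.
exists D; rewrite /is_tree -/(P D) PD /=; apply/forall_inP => e eD; apply/negP => /connP ee.
suff /minD/(_ (subD1set _ _)) DD : P (D :\ e) by move: eD; rewrite -DD setD11.
apply/forallP => x; apply/forallP => y; apply/connP.
have /forallP/(_ x)/forallP/(_ y) := PD; rewrite -{1}(setD1K eD).
by case/connect_add/or3P => [/connP//||] /andP[/connP h1 /connP h2];
  [rewrite h1 ee h2 | rewrite h1 -ee h2].
Qed.

End Connectivity.

(** * Exchange families and minimum spanning trees *)

Section ExchangeFamily.

Variable E : finType.
Implicit Types (B : pred {set E}) (X A : {set E}) (a b u v : E).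

(** Symmetric base exchange of matroids, for an arbitrary family: it is applied to minimum trees for
    reduced costs and to complements of such trees. *)
Definition exchangeable B := forall A A' e, B A -> B A' -> e \in A :\: A' ->
  exists2 f, f \in A' :\: A & B (f |: A :\ e) && B (e |: A' :\ f).

Definition swappable B X u v := [&& u \in X, v \notin X & B (v |: X :\ u)].

Lemma neq_eqF u v : u != v -> ((u == v) = false) * ((v == u) = false).
Proof. by move=> uv; rewrite [v == u]eq_sym (negPf uv). Qed.

(** Passage to the dual matroid. It turns the arcs of [Y], whose head leaves the tree, into swaps
    whose tail leaves the base. *)
Lemma exchangeableC B : exchangeable B -> exchangeable (fun D => B (~: D)).
Proof.
move=> exB A A' e BA BA' eA.
have eA' : e \in ~: A' :\: ~: A by move: eA; rewrite !inE negbK andbC.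
have [f fA /andP[B1 B2]] := exB _ _ _ BA' BA eA'.
exists f; first by move: fA; rewrite !inE negbK andbC.
have fe : f != e.
  apply: contraTneq fA => ->; move: eA; rewrite !inE => /andP[_ ->].
  by rewrite andbF.
have -> : ~: (f |: A :\ e) = e |: ~: A :\ f.
  apply/setP => z; rewrite !inE; case: (eqVneq z f) => [->|zf] /=.
    by rewrite (negPf fe).
  by rewrite negb_and negbK.
have -> : ~: (e |: A' :\ f) = f |: ~: A' :\ e.
  apply/setP => z; rewrite !inE; case: (eqVneq z e) => [->|ze] /=.
    by rewrite eq_sym (negPf fe).
  by rewrite negb_and negbK.
by rewrite B1 B2.
Qed.

(** Exchange [u] between X - a + b and X - u + v: the partner is [v] or [a]. With [v] the first base
    becomes the desired one; with [a] the second becomes X - a + v, which is excluded. *)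
Lemma swap_keeps_arc B X u v a b : exchangeable B ->
  swappable B X u v -> swappable B X a b -> ~~ swappable B X a v ->
  a != u -> b != v -> swappable B (v |: X :\ u) a b.
Proof.
move=> exB /and3P[uX vX Buv] /and3P[aX bX Bab] nav.
move=> /neq_eqF au /neq_eqF bv.
have /neq_eqF av : a != v by apply: contraNneq vX => <-.
have /neq_eqF bu : b != u by apply: contraNneq bX => ->.
have /neq_eqF uv : u != v by apply: contraNneq vX => <-.
apply/and3P; split; first by rewrite !inE aX au orbT.
  by rewrite !inE bv (negPf bX) andbF.
have uA : u \in (b |: X :\ a) :\: (v |: X :\ u).
  by rewrite !inE eqxx uv uX au orbT.
have [f] := exB _ _ _ Bab Buv uA.
rewrite !inE negb_or negb_and negbK => /andP[/andP[fb fa]].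
case: (eqVneq f v) => [->|fv] /= fX /andP[B1 B2].
  congr (B _): B1; apply/setP => z; rewrite !inE.
  case: (eqVneq z v) => [->|zv] /=; first by rewrite bv av.
  case: (eqVneq z b) => [->|zb] /=; first by rewrite bu.
  by rewrite andbCA.
have fa' : f = a by case/orP: fa => [/eqP//|]; case/andP: fX => _ ->.
case/negP: nav; rewrite /swappable aX vX /=.
congr (B _): B2; rewrite fa'; apply/setP => z; rewrite !inE.
case: (eqVneq z u) => [->|zu] /=; first by rewrite uv au uX.
by case: (eqVneq z v) => [->|zv] //=; rewrite av.
Qed.

(** If X - u + v - a + b were a base, exchanging [a] between [X] and it would bring in [b] or [v],
    giving an arc from [a] that is excluded. For [b = u] that base is X - a + v itself. *)
Lemma swap_keeps_nonarc B X u v a b : exchangeable B -> B X ->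
  swappable B X u v -> ~~ swappable B X a v -> ~~ swappable B X a b ->
  a != v -> ~~ swappable B (v |: X :\ u) a b.
Proof.
move=> exB BX /and3P[uX vX Buv] nav nab /neq_eqF av; apply/negP => /and3P[].
rewrite !inE av /= => /andP[/neq_eqF au aX]; rewrite negb_or negb_and negbK.
move=> /andP[/neq_eqF bv bX] Bab.
case/orP: bX => [/eqP bu|bX].
  case/negP: nav; rewrite /swappable aX vX /=.
  congr (B _): Bab; rewrite bu; apply/setP => z; rewrite !inE.
  case: (eqVneq z u) => [->|zu] /=; first by rewrite au uX orbT.
  by case: (eqVneq z v) => [->|zv] //=; rewrite av.
have /neq_eqF ab : a != b by apply: contraNneq bX => <-.
have aA : a \in X :\: (b |: (v |: X :\ u) :\ a).
  by rewrite !inE aX eqxx ab.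
have [f] := exB _ _ _ BX Bab aA.
rewrite !inE => /andP[fX ff] /andP[B1 _].
have /orP[/eqP fb|/eqP fv] : (f == b) || (f == v).
- by move: ff; rewrite (negPf fX); case: (f == b); case: (f == v); rewrite /= ?andbF.
- by case/negP: nab; rewrite /swappable aX bX -fb.
- by case/negP: nav; rewrite /swappable aX vX -fv.
Qed.

End ExchangeFamily.

Local Open Scope ring_scope.

(** * Minimum spanning trees form an exchange family *)

Section MinTrees.

Variables (R : realFieldType) (G : graph).
Implicit Types (w : 'I_(ne G) -> R) (T : {set 'I_(ne G)}) (e f : 'I_(ne G)).

Lemma cost_swap w T f e : f \in T -> e \notin T ->
  cost w (e |: T :\ f) = cost w T + w e - w f.
Proof.
move=> fT eT; rewrite /cost big_setU1 /=; last by rewrite !inE (negPf eT) andbF.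
by rewrite (big_setD1 f fT) /=; ring.
Qed.

Definition min_tree w T : bool :=
  is_tree T && [forall T', is_tree T' ==> (cost w T <= cost w T')].

Lemma min_treeP w T : reflect
  (is_tree T /\ forall T', is_tree T' -> cost w T <= cost w T') (min_tree w T).
Proof.
apply: (iffP andP) => -[tT mT]; split=> //.
  by move=> T'; apply/implyP; move/forallP: mT.
by apply/forallP => T'; apply/implyP; apply: mT.
Qed.

Lemma min_tree_tree w T : min_tree w T -> is_tree T.
Proof. by case/andP. Qed.

Lemma min_tree_exists w : connected_graph G -> exists T, min_tree w T.
Proof.
move=> /tree_exists[T0 tT0].
exists [arg min_(T < T0 | is_tree T) cost w T]%O; apply/min_treeP.
by case: arg_minP => // T tT mT; split.
Qed.

Lemma min_tree_le w T f e : min_tree w T -> f \in T -> e \notin T ->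
  is_tree (e |: T :\ f) -> w f <= w e.
Proof.
move=> /min_treeP[_ mT] fT eT /mT; rewrite cost_swap //; lra.
Qed.

Lemma min_tree_swap w T f e : min_tree w T -> f \in T -> e \notin T ->
  min_tree w (e |: T :\ f) = is_tree (e |: T :\ f) && (w e == w f).
Proof.
move=> mT fT eT; apply/idP/andP => [m|[t /eqP we]].
  split; first exact: min_tree_tree m.
  have h := min_tree_le mT fT eT (min_tree_tree m).
  case/min_treeP: m => _ /(_ _ (min_tree_tree mT)); rewrite cost_swap //.
  by move=> h'; apply/eqP; lra.
apply/min_treeP; split=> // T' tT'; case/min_treeP: mT => _ /(_ _ tT').
by rewrite cost_swap //; lra.
Qed.

(** The two swaps of [tree_exchange] change the costs by opposite amounts; neither can be negative,
    so both vanish. *)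
Lemma min_tree_exchange w : exchangeable (min_tree w).
Proof.
move=> T1 T2 e m1 m2 eT.
have [f fT /andP[t1 t2]] :=
  tree_exchange (min_tree_tree m1) (min_tree_tree m2) eT.
exists f => //; move: eT fT; rewrite !inE => /andP[e2 e1] /andP[f1 f2].
have h1 := min_tree_le m1 e1 f1 t1; have h2 := min_tree_le m2 f2 e2 t2.
have wef : w e = w f by lra.
by rewrite !min_tree_swap // t1 t2 wef eqxx.
Qed.

(** Induction on the size of [T :\: T']: symmetric exchange moves [T'] closer to [T] by a swap that
    local optimality of [T] shows not to increase the cost. *)
Lemma min_tree_local w T : is_tree T ->
  (forall f e, f \in T -> e \notin T -> is_tree (e |: T :\ f) -> w f <= w e) ->
  min_tree w T.
Proof.
move=> tT loc; apply/min_treeP; split=> // T'.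
have [n] := ubnP #|T :\: T'|; elim: n T' => // n IHn T' le_n tT'.
have [TT'|[e eT]] := set_0Vmem (T :\: T').
  have [T'T|[e eT']] := set_0Vmem (T' :\: T).
    suff -> : T = T' by [].
    by apply/eqP; rewrite eqEsubset -!setD_eq0 TT' T'T eqxx.
  by have [f] := tree_exchange tT' tT eT'; rewrite TT' inE.
have [f fT /andP[t1 t2]] := tree_exchange tT tT' eT.
have lt : (#|T :\: (e |: T' :\ f)| < n)%N.
  rewrite ltnS in le_n; apply: leq_trans le_n; apply: proper_card.
  apply/properP; split; last first.
    by exists e => //; rewrite !inE eqxx.
  apply/subsetP => z; rewrite !inE negb_or negb_and negbK => /andP[/andP[_ zT'] zT].
  rewrite zT andbT; case/orP: zT' => // /eqP zf.
  by move: fT; rewrite -zf inE zT.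
have := IHn _ lt t2.
move: eT fT; rewrite !inE => /andP[e2 e1] /andP[f1 f2].
rewrite cost_swap //; have := loc e f e1 f1 t1; lra.
Qed.

End MinTrees.

(** * Certificates, search and augmentation *)

Section Certificate.

Variables (R : realFieldType) (G : graph) (C c : 'I_(ne G) -> R).
Local Notation E := 'I_(ne G).
Implicit Types (X Y : {set E}) (al key : E -> R) (th : R) (u v a b : E).
Implicit Types (D : E -> bool -> bool) (p n : nat) (t : bool) (d : R).
Implicit Types (par : E -> nat) (ty : E -> bool) (q r : seq E).

(* With y_e = th - al_e, these are the costs C - al and c - y of the two trees in
   the Lagrangian relaxation, up to the constant th in the second one. *)
Definition redX al v := C v - al v.
Definition redY al v := c v + al v.

Definition certificate X Y al th : Prop :=
  [/\ min_tree (redX al) X, min_tree (redY al) Y,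
      forall e, 0 <= al e <= th,
      forall e, e \in X :\: Y -> al e = 0 &
      forall e, e \in Y :\: X -> al e = th].

Lemma cost_redX al X : cost (redX al) X = cost C X - cost al X.
Proof. by rewrite /cost -sumrB. Qed.

Lemma cost_redY al Y : cost (redY al) Y = cost c Y + cost al Y.
Proof. by rewrite /cost -big_split. Qed.

Lemma cost_diff al X Y :
  cost al X - cost al Y = cost al (X :\: Y) - cost al (Y :\: X).
Proof.
rewrite /cost (big_setID Y) /= [\sum_(e in Y) _](big_setID X) /= setIC.
ring.
Qed.

Lemma certificate_opt k X Y al th X' Y' : certificate X Y al th ->
  (#|Y :\: X| <= k)%N -> th = 0 \/ (k <= #|Y :\: X|)%N ->
  is_tree X' -> is_tree Y' -> (#|Y' :\: X'| <= k)%N ->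
  cost C X + cost c Y <= cost C X' + cost c Y'.
Proof.
case=> /min_treeP[_ mX] /min_treeP[_ mY] al0 alX alY kY kth tX' tY' kY'.
have := mX _ tX'; have := mY _ tY'; rewrite !cost_redX !cost_redY.
have := cost_diff al X Y; have := cost_diff al X' Y'.
have -> : cost al (X :\: Y) = 0 by rewrite /cost big1.
have -> : cost al (Y :\: X) = th *+ #|Y :\: X|.
  by rewrite /cost (eq_bigr (fun=> th)) // sumr_const.
have h1 : 0 <= cost al (X' :\: Y').
  by apply: sumr_ge0 => e _; case/andP: (al0 e).
have h2 : cost al (Y' :\: X') <= th *+ #|Y' :\: X'|.
  rewrite -sumr_const; apply: ler_sum => e _; by case/andP: (al0 e).
have h3 : th *+ #|Y' :\: X'| <= th *+ #|Y :\: X|.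
  case: kth => [->|kth]; first by rewrite !mul0rn.
  (* [0 <= th] is read off from the bounds on [al] at some edge; if both differences are empty, both
     sides are 0. *)
  have [->|[e eY]] := set_0Vmem (Y' :\: X').
    rewrite cards0 mulr0n; have [->|[e eY]] := set_0Vmem (Y :\: X).
      by rewrite cards0.
    by apply: mulrn_wge0; case/andP: (al0 e) => /le_trans h /h.
  have /andP[/le_trans h /h th0] := al0 e.
  by apply: ler_wpMn2l => //; apply: leq_trans kth.
move: h1 h2 h3; lra.
Qed.

Lemma certificate_solution k X Y al th : certificate X Y al th ->
  (#|Y :\: X| <= k)%N -> th = 0 \/ (k <= #|Y :\: X|)%N ->
  rec_st_solution C c k X Y.
Proof.
move=> cert kY kth; have opt := certificate_opt cert kY kth.
have [/min_tree_tree tX /min_tree_tree tY _ _ _] := cert.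
have rY : recovery_set k X Y by split=> //; apply/spanning_treeP.
split=> //; first exact/spanning_treeP.
split=> [|w [X' [r [/spanning_treeP tX' [[Y' [/spanning_treeP tY' kY'] ->] _] ->]]]].
  exists X, (cost c Y); split=> //; first exact/spanning_treeP.
  split=> [|w [Y' [/spanning_treeP tY' kY'] ->]]; first by exists Y.
  (* The choice X' = X shows that [Y] is an optimal recovery of [X]. *)
  have := opt X Y' tX tY' kY'; lra.
exact: opt.
Qed.

(** * The exchange graph, its potentials and the Hungarian search *)

Definition exch_arc X Y (t : bool) u v : bool :=
  if t then [&& u \in X, v \notin X & is_tree (v |: X :\ u)]
  else [&& u \notin Y, v \in Y & is_tree (u |: Y :\ v)].

(** Increase in reduced cost under the swap of the arc: [v] replaces [u] in [X] when [t] holds, and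
    [u] replaces [v] in [Y] otherwise. *)
Definition slack al (t : bool) u v : R :=
  if t then redX al v - redX al u else redY al u - redY al v.

Lemma slack_ge0 X Y al th t u v :
  certificate X Y al th -> exch_arc X Y t u v -> 0 <= slack al t u v.
Proof.
case=> mX mY _ _ _; case: t => /and3P[uX vX t]; rewrite subr_ge0.
  exact: min_tree_le mX _ _ t.
exact: min_tree_le mY _ _ t.
Qed.

Definition raise q al (d : R) v := if v \in q then al v else al v + d.

Lemma slack_raise q al d t u v : slack (raise q al d) t u v =
  slack al t u v - (if v \in q then 0 else d) + (if u \in q then 0 else d).
Proof.
rewrite /slack /raise /redX /redY.
by case: t; case: (u \in q); case: (v \in q); ring.
Qed.

(** Each hypothesis protects a clause: sources outside [q] keep [al = 0] because then [d = 0]; sinks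
    lie outside [q] and rise with [th]; slacks stay nonnegative, which by [min_tree_local] keeps
    both trees minimum. *)
Lemma certificate_raise X Y al th q d : certificate X Y al th -> 0 <= d ->
  (forall e, e \in X :\: Y -> e \notin q -> d = 0) ->
  (forall e, e \in q -> e \notin Y :\: X) ->
  (forall t u v, u \in q -> v \notin q -> exch_arc X Y t u v -> d <= slack al t u v) ->
  certificate X Y (raise q al d) (th + d).
Proof.
move=> cert d0 dX dY ds; have [mX mY al0 alX alY] := cert.
have ge0 t u v : exch_arc X Y t u v -> 0 <= slack (raise q al d) t u v.
  move=> uv; rewrite slack_raise; have := slack_ge0 cert uv.
  have := ds t u v; case: (u \in q); case: (v \in q) => /=; try lra.
  by move=> /(_ isT isT uv); lra.
split.
- apply: min_tree_local (min_tree_tree mX) _ => u v uX vX t.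
  by rewrite -subr_ge0; apply: (ge0 true); apply/and3P.
- apply: min_tree_local (min_tree_tree mY) _ => u v uY vY t.
  by rewrite -subr_ge0; apply: (ge0 false); apply/and3P.
- by move=> e; rewrite /raise; have := al0 e; case: (e \in q) => /andP[]; lra.
- move=> e eX; rewrite /raise; case: ifPn => [_|/(dX _ eX)->]; rewrite ?addr0; exact: alX.
- move=> e eY; rewrite /raise; case: ifPn => [/dY|_]; first by rewrite eY.
  by rewrite alY.
Qed.

Lemma source_arc X Y e : is_tree X -> is_tree Y -> e \in Y :\: X ->
  exists2 u, u \in X :\: Y & exch_arc X Y true u e.
Proof.
move=> tX tY eY; have [u uX /andP[_ t]] := tree_exchange tY tX eY.
exists u => //; rewrite /exch_arc t; move: eY uX.
by rewrite !inE => /andP[-> _] /andP[_ ->].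
Qed.

(** Stated as a swap between minimum trees, so that the lemmas on exchange families apply; the
    complement gives the arcs of [Y] the same direction as those of [X]. *)
Definition tight_arc al X Y (t : bool) u v : bool :=
  if t then swappable (min_tree (redX al)) X u v
  else swappable (fun Z => min_tree (redY al) (~: Z)) (~: Y) u v.

Lemma tight_arcE X Y al th t u v : certificate X Y al th ->
  tight_arc al X Y t u v = exch_arc X Y t u v && (slack al t u v == 0).
Proof.
case=> mX mY _ _ _; case: t; rewrite /tight_arc /swappable /exch_arc /slack subr_eq0.
  case: (boolP (u \in X)) => //= uX; case: (boolP (v \in X)) => //= vX.
  exact: min_tree_swap.
rewrite !inE negbK; case: (boolP (u \in Y)) => //= uY.
case: (boolP (v \in Y)) => //= vY.
have -> : ~: (v |: ~: Y :\ u) = u |: Y :\ v.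
  have /neq_eqF uv : u != v by apply: contraNneq uY => ->.
  apply/setP => z; rewrite !inE negb_or negb_and !negbK.
  by case: (eqVneq z u) => [->|] //=; rewrite uv.
by rewrite (min_tree_swap mY) // eq_sym.
Qed.

(* The list q is the search set in order of insertion, and D the set of arcs
   leaving it that have been scanned.  The strict inequality for arcs from nodes
   inserted before the parent is what excludes shortcuts later on.  Parents are
   stored with offset one, 0 meaning none, and a source is its own parent. *)
Definition entering X Y q (D : E -> bool -> bool) al (p : nat) (t : bool) (d : R) v
    : Prop :=
  (p = 0%N /\ forall u t', D u t' -> ~~ exch_arc X Y t' u v) \/
  exists u, [/\ p = u.+1, D u t, exch_arc X Y t u v, d = slack al t u v &
    forall u' t', D u' t' -> exch_arc X Y t' u' v -> d <= slack al t' u' v /\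
      ((index u' q < index u q)%N -> d < slack al t' u' v)].

(** Counterpart of [entering] after insertion. The parent arc has become tight and stays so, since
    [al] is no longer raised at either end. *)
Definition entered X Y q al (p : nat) (t : bool) v : Prop :=
  exists u, [/\ p = u.+1, (index u q < index v q)%N, exch_arc X Y t u v,
    slack al t u v = 0 &
    forall u' t', (index u' q < index u q)%N -> exch_arc X Y t' u' v ->
      slack al t' u' v != 0].

Definition search X Y q D al par ty key : Prop :=
  [/\ uniq q, forall e, e \in X :\: Y -> par e = e.+1 /\ (e \notin q -> key e = 0),
      forall v, v \notin X :\: Y -> v \notin q -> entering X Y q D al (par v) (ty v) (key v) v &
      forall v, v \notin X :\: Y -> v \in q -> entered X Y q al (par v) (ty v) v].

Definition lower q key (d : R) v := if v \in q then key v else key v - d.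

(** A sink has an arc from some source. If that source is outside [q], it is itself a candidate;
    otherwise it has been scanned and the sink has a parent. *)
Lemma search_candidate X Y q al par ty key th :
  certificate X Y al th -> search X Y q (fun u _ => u \in q) al par ty key ->
  (forall e, e \in q -> e \notin Y :\: X) -> (0 < #|Y :\: X|)%N ->
  exists v, (v \notin q) && (par v != 0%N).
Proof.
move=> [/min_tree_tree tX /min_tree_tree tY _ _ _] [_ src ent _] qY /card_gt0P[e eY].
have [u uX ue] := source_arc tX tY eY.
case: (boolP (u \in q)) => uq; last first.
  by exists u; rewrite uq; case: (src u uX) => ->.
have eq : e \notin q by apply: contraTN eY; apply: qY.
exists e; rewrite eq /=.
have eX : e \notin X :\: Y by move: eY; rewrite !inE => /andP[/negPf-> _]; rewrite andbF.
case: (ent e eX eq) => [[_ /(_ u true uq)]|[w [-> //]]].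
by rewrite ue.
Qed.

(** Minimality of [key b] bounds the slack of every arc leaving [q], and makes [key b] vanish while
    a source is outside, as [certificate_raise] asks. Slacks out of [q] and keys outside drop by the
    same amount, so the comparisons in [entering] persist and the parent arc of [b] becomes
    tight. *)
Lemma search_pick X Y q al par ty key th b :
  certificate X Y al th -> search X Y q (fun u _ => u \in q) al par ty key ->
  (forall e, e \in q -> e \notin Y :\: X) ->
  b \notin q -> par b != 0%N ->
  (forall v, v \notin q -> par v != 0%N -> key b <= key v) ->
  let al' := raise q al (key b) in
  certificate X Y al' (th + key b) /\
  search X Y (rcons q b) (fun u _ => u \in q) al' par ty (lower q key (key b)).
Proof.
move=> cert [uq src ent entd] qY bq pb mb al'.
have sl t u v : u \in q -> v \notin q -> exch_arc X Y t u v -> key b <= slack al t u v.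
  move=> uI vq uv; case: (boolP (v \in X :\: Y)) => vX.
    have [pv kv] := src v vX; apply: le_trans (slack_ge0 cert uv).
    by rewrite -(kv vq); apply: mb; rewrite // pv.
  case: (ent v vX vq) => [[_ /(_ u t uI)]|[w [pv _ _ kv min]]]; first by rewrite uv.
  have [h _] := min u t uI uv; apply: le_trans h; apply: mb => //.
  by rewrite pv.
have kb0 : 0 <= key b.
  case: (boolP (b \in X :\: Y)) => bX; first by case: (src b bX) => _ ->.
  case: (ent b bX bq) => [[pb0]|[w [_ _ wb -> _]]]; first by rewrite pb0 in pb.
  exact: slack_ge0 cert wb.
have kbX e : e \in X :\: Y -> e \notin q -> key b = 0.
  move=> eX eq; apply/eqP; rewrite eq_le kb0 andbT.
  by have [pe <-//] := src e eX; apply: mb; rewrite // pe.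
have idx u : u \in q -> index u (rcons q b) = index u q.
  by move=> uI; rewrite -cats1 index_cat uI.
have idxb : index b (rcons q b) = size q.
  by rewrite -cats1 index_cat (negPf bq) /= eqxx addn0.
have lti u u' : u \in q -> (index u' (rcons q b) < index u (rcons q b))%N ->
    u' \in q /\ (index u' q < index u q)%N.
  move=> uI; rewrite (idx u uI) -cats1 index_cat; case: ifP => // _.
  rewrite -index_mem in uI => h; have := ltn_trans h uI.
  by rewrite ltnNge leq_addr.
split; first exact: certificate_raise.
split.
- by rewrite rcons_uniq bq.
- move=> e eX; have [pe ke] := src e eX; split=> //.
  rewrite mem_rcons inE negb_or => /andP[_ eq].
  by rewrite /lower (negPf eq) (kbX e) // ke // subr0.
- move=> v vX; rewrite mem_rcons inE negb_or => /andP[vb vq].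
  case: (ent v vX vq) => [?|[w [pv wq wv kv min]]]; [by left|right].
  exists w; split=> //.
    by rewrite /lower (negPf vq) kv slack_raise wq (negPf vq); ring.
  move=> u' t u'q u'v; have [h1 h2] := min u' t u'q u'v.
  rewrite /lower (negPf vq) slack_raise u'q (negPf vq) !idx //; split; first lra.
  by move=> /h2; lra.
- move=> v vX; rewrite mem_rcons inE; case: (eqVneq v b) vX => [-> bX _|vb vX /= vq].
    case: (ent b bX bq) => [[pb0]|[w [pw wq wb kb min]]]; first by rewrite pb0 in pb.
    exists w; split=> //; first by rewrite idxb idx // index_mem.
      by rewrite slack_raise wq (negPf bq) -kb; ring.
    move=> u' t u'w u'b; have [u'q u'lt] := lti w u' wq u'w.
    have [_ h] := min u' t u'q u'b.
    by rewrite slack_raise u'q (negPf bq); have := h u'lt; lra.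
  have [w [pv wlt wv sw min]] := entd v vX vq.
  have wq : w \in q by rewrite -index_mem (ltn_trans wlt) ?index_mem.
  exists w; split=> //; first by rewrite !idx.
    by rewrite slack_raise wq vq sw; ring.
  move=> u' t u'w u'v; have [u'q u'lt] := lti w u' wq u'w.
  by rewrite slack_raise u'q vq subr0 addr0; apply: min.
Qed.

Lemma entering_eq X Y q D D' al p t d v : (forall u t', D u t' = D' u t') ->
  entering X Y q D al p t d v -> entering X Y q D' al p t d v.
Proof.
move=> DD [[p0 h]|[u [pu Du uv du h]]]; [left|right].
  by split=> // u t' Du; apply: h; rewrite DD.
exists u; split=> //; first by rewrite -DD.
by move=> u' t'; rewrite -DD; apply: h.
Qed.

(** No scanned node comes after [u]. Without an update the parent is not later than [u], so
    strictness is not demanded of [u]; an update requires a strict decrease, so all arcs scanned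
    before are strictly worse. *)
Lemma entering_relax X Y q D al p t d v u t' :
  (forall w s, D w s -> index w q <= index u q)%N ->
  entering X Y q D al p t d v ->
  let D' w s := D w s || (w == u) && (s == t') in
  let s' := slack al t' u v in
  let upd := exch_arc X Y t' u v && ((p == 0%N) || (s' < d)) in
  entering X Y q D' al (if upd then u.+1 else p) (if upd then t' else t)
    (if upd then s' else d) v.
Proof.
move=> le_u ent D' s' upd; case: (boolP upd) => [/andP[uv lt]|nupd]; last first.
  case: ent nupd => [[p0 h]|[w [pw Dw wv dw h]]]; rewrite /upd.
    rewrite p0 /= andbT => nuv; left; split=> // w s /orP[/h//|/andP[/eqP-> /eqP->] //].
  rewrite pw => nuv; right; exists w; split=> //; first by rewrite /D' Dw.
  move=> u' r /orP[/h//|/andP[/eqP-> /eqP->]] uv.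
  move: nuv; rewrite uv /= -leNgt => ds; split=> //.
  by rewrite ltnNge (le_u w t).
right; exists u; split=> //; first by rewrite /D' !eqxx orbT.
move=> u' r /orP[Du'|/andP[/eqP-> /eqP->] _]; last by rewrite ltnn lexx.
case: ent lt => [[_ /(_ _ _ Du') h]|[w [-> _ _ _ h]]]; first by rewrite (negPf h).
move=> /= sd u'v; have [h1 _] := h _ _ Du' u'v; have := lt_le_trans sd h1.
by move=> h2; split=> [|_ //]; apply: ltW.
Qed.

Fixpoint trail par v r : Prop :=
  if r is u :: r' then par v = u.+1 /\ trail par u r' else par v = v.+1.

Fixpoint shortest al X Y ty v r : Prop :=
  if r is u :: r' then
    [/\ tight_arc al X Y (ty v) u v,
        forall a t, a \in r' -> ~~ tight_arc al X Y t a v & shortest al X Y ty u r']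
  else True.

(** Ancestors precede their descendants in [q], so a tight shortcut into [v] would start at a node
    inserted before the parent of [v], against [entered]. A source ends the trail, hence occurs only
    there. *)
Lemma search_trail X Y q D al par ty key th v :
  certificate X Y al th -> search X Y q D al par ty key -> v \in q ->
  exists r, [/\ trail par v r, shortest al X Y ty v r, last v r \in X :\: Y,
    forall e, e \in v :: r -> e \in X :\: Y -> e = last v r &
    uniq (v :: r) /\ forall e, e \in r -> (index e q < index v q)%N].
Proof.
move=> cert [uq src _ entd].
have [n] := ubnP (index v q); elim: n v => // n IHn v lt_n vq.
case: (boolP (v \in X :\: Y)) => vX.
  exists [::]; split=> //; first by case: (src v vX).
  by move=> e; rewrite inE => /eqP.
have [u [pv uv arcu sl0 min]] := entd v vX vq.
have uq' : u \in q by rewrite -index_mem (ltn_trans uv) ?index_mem.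
have [r [tr sh lX intr [ur lt]]] := IHn u (leq_trans uv lt_n) uq'.
have lt' e : e \in u :: r -> (index e q < index v q)%N.
  by rewrite inE => /orP[/eqP->//|/lt h]; apply: ltn_trans uv.
exists (u :: r); split=> //.
- split=> //; first by rewrite (tight_arcE _ _ _ cert) arcu sl0 eqxx.
  move=> a t /lt au; rewrite (tight_arcE _ _ _ cert) negb_and.
  by case: (boolP (exch_arc X Y t a v)) => //= av; apply: min.
- move=> e; rewrite inE => /orP[/eqP->|]; last exact: intr.
  by rewrite (negPf vX).
split=> //; rewrite cons_uniq ur andbT.
by apply/negP => /lt'; rewrite ltnn.
Qed.

(** * Augmentation along a shortest tight path *)

Definition augX (t : bool) u v X := if t then v |: X :\ u else X.
Definition augY (t : bool) u v Y := if t then Y else u |: Y :\ v.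

Lemma setC_swap Y u v : u != v -> ~: (u |: Y :\ v) = v |: ~: Y :\ u.
Proof.
move=> /neq_eqF uv; apply/setP => z; rewrite !inE negb_or negb_and negbK.
by case: (eqVneq z u) => [->|] //=; rewrite uv.
Qed.

Lemma tight_arc_aug al X Y t u v t' a b :
  min_tree (redX al) X -> min_tree (redY al) Y -> tight_arc al X Y t u v ->
  (forall t, ~~ tight_arc al X Y t a v) -> a != u -> a != v -> b != v ->
  tight_arc al (augX t u v X) (augY t u v Y) t' a b = tight_arc al X Y t' a b.
Proof.
move=> mX mY uv na au av bv.
have exX := @min_tree_exchange _ _ (redX al).
have exY := exchangeableC (@min_tree_exchange _ _ (redY al)).
have mY' : min_tree (redY al) (~: ~: Y) by rewrite setCK.
case: t uv (na true) (na false); case: t' => //= uv naX naY.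
  apply/idP/idP; last by move=> ab; apply: swap_keeps_arc.
  by apply: contraTT => nab; apply: swap_keeps_nonarc.
have uv' : u != v.
  by case/and3P: uv; rewrite !inE negbK => uY vY _; apply: contraNneq uY => ->.
rewrite /tight_arc setC_swap //; apply/idP/idP; last first.
  by move=> ab; apply: swap_keeps_arc.
by apply: contraTT => nab; apply: (swap_keeps_nonarc exY).
Qed.

(** The swap along u -> v spares the rest of the path: no arc there ends in [v] or starts from [u]
    or [v], and no tail of such an arc has a tight arc into [v]. *)
Lemma shortest_aug al X Y ty t u v x r :
  min_tree (redX al) X -> min_tree (redY al) Y -> tight_arc al X Y t u v ->
  v \notin x :: r -> u \notin r ->
  (forall a t, a \in r -> ~~ tight_arc al X Y t a v) ->
  shortest al X Y ty x r ->
  shortest al (augX t u v X) (augY t u v Y) ty x r.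
Proof.
move=> mX mY uv; elim: r x => //= y r IHr x; rewrite !inE !negb_or.
move=> /and3P[vx vy vr] /andP[uy ur] na [yx nax sh]; split.
- rewrite tight_arc_aug //; [|by rewrite eq_sym..].
  by move=> t'; apply: na; rewrite mem_head.
- move=> a t' ar; rewrite tight_arc_aug //; first exact: nax.
  + by move=> t''; apply: na; rewrite inE ar orbT.
  + by apply: contraNneq ur => <-.
  + by apply: contraNneq vr => <-.
  + by rewrite eq_sym.
apply: IHr => //; first by rewrite inE negb_or vy.
by move=> a t' ar; apply: na; rewrite inE ar orbT.
Qed.

(* Invariant of the backward walk along the path v :: r, r leading to a source:
   complementary slackness fails at v only, until the source is reached. *)
Definition augmenting X Y al th ty n v r : Prop :=
  if r is [::] then certificate X Y al th /\ #|Y :\: X| = n else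
  [/\ [/\ min_tree (redX al) X, min_tree (redY al) Y, forall e, 0 <= al e <= th,
        forall e, e \in X :\: Y -> al e = 0 &
        forall e, e \in Y :\: X -> e != v -> al e = th],
      v \in Y :\: X /\ #|Y :\: X| = n.+1, shortest al X Y ty v r, uniq (v :: r)
    & last v r \in X :\: Y /\
      forall e, e \in r -> e != last v r -> (e \in X) = (e \in Y)].

(** The swap removes [v] from Y \ X, by putting it into [X] or taking it out of [Y]. An intermediate
    [u], lying in both trees or in neither, takes the place of [v] as the only violation; a source
    [u] merely leaves X \ Y, and the difference shrinks. *)
Lemma augmenting_step X Y al th ty n v u r :
  augmenting X Y al th ty n v (u :: r) ->
  augmenting (augX (ty v) u v X) (augY (ty v) u v Y) al th ty n u r.
Proof.
move=> [[mX mY al0 alX alY] [vYX cardn] /= [uv na sh] /and3P[vr ur uniqr] [lX mid]].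
have /andP[vX vY] : (v \notin X) && (v \in Y) by move: vYX; rewrite inE.
have sh' := shortest_aug mX mY uv vr ur na sh.
have /neq_eqF vu : v != u by move: vr; rewrite inE negb_or => /andP[].
move: uv sh'; set t := ty v; set X' := augX t u v X; set Y' := augY t u v Y.
move=> uv sh'.
have uXY : if r is [::] then (u \in X) && (u \notin Y) else (u \in X) = (u \in Y).
  case: r {sh sh' vr na} lX mid ur uniqr => [|y r] /=; first by rewrite inE andbC.
  move=> _ /(_ u (mem_head _ _)) h ur _; apply: h.
  by apply: contraNneq ur => ->; apply: mem_last.
have uvt : if t then u \in X else u \notin Y.
  by move: uv; case: (t) => /and3P[]; rewrite ?inE.
have mX' : min_tree (redX al) X'.
  by rewrite /X' /augX; move: uv; case: (t) => // /and3P[].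
have mY' : min_tree (redY al) Y'.
  rewrite /Y' /augY; move: uv; case: (t) => // /and3P[_ _].
  by rewrite -setC_swap ?setCK // vu.
have XY' e : e \in X' :\: Y' -> e \in X :\: Y /\ e != u.
  rewrite /X' /Y' /augX /augY; case: (t) => /=; rewrite !inE.
    case: (eqVneq e v) => [->|ev] /=; first by rewrite vY.
    by move=> /and3P[-> -> ->].
  case: (eqVneq e u) => //= eu; case: (eqVneq e v) => [->|ev] /=.
    by rewrite (negPf vX).
  by move=> /andP[-> ->].
have YX' e : (e \in Y' :\: X') =
    ((e \in Y :\: X) && (e != v)) || ((e == u) && (r != [::])).
  rewrite /X' /Y' /augX /augY; move: uXY uvt; case: (t) => /=; rewrite !inE.
    case: (eqVneq e u) => [->|eu] /=; last by rewrite orbF; case: (e == v); rewrite /= ?andbF ?andbT ?orbF.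
    by rewrite vu; case: (r) => [|? ?]; case: (u \in X); case: (u \in Y).
  case: (eqVneq e u) => [->|eu] /=.
    by rewrite vu; case: (r) => [|? ?]; case: (u \in X); case: (u \in Y).
  by rewrite orbF => _ _; case: (e == v); rewrite /= ?andbF ?andbT.
have uYX : u \notin Y :\: X.
  rewrite inE; move: uXY; case: (r) => [|_ _]; first by move=> /andP[->].
  by move=> ->; case: (u \in Y).
have cardv : #|(Y :\: X) :\ v| = n by move: cardn; rewrite (cardsD1 v) vYX => -[].
have alX' e : e \in X' :\: Y' -> al e = 0 by move=> /XY'[/alX].
case: r => [|y r] in vr ur uniqr uXY sh sh' na lX mid YX' *.
  split; last by rewrite -cardv; congr #|pred_of_set _|; apply/setP => e; rewrite YX' in_setD1 andbF orbF andbC.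
  split=> // e; rewrite YX' andbF orbF => /andP[eY ev]; exact: alY.
split=> //.
- split=> // e; rewrite YX' andbT => /orP[/andP[eY ev] _|->//]; exact: alY.
- rewrite YX' eqxx orbT; split=> //.
  have -> : Y' :\: X' = u |: (Y :\: X) :\ v.
    by apply/setP => e; rewrite YX' in_setU1 in_setD1 andbT orbC [_ && (e != v)]andbC.
  by rewrite cardsU1 cardv in_setD1 (negPf uYX) andbF.
- by rewrite cons_uniq ur.
have out e : e \in y :: r -> (e \in X') = (e \in X) /\ (e \in Y') = (e \in Y).
  move=> er; have /negPf eu : e != u by apply: contraNneq ur => <-.
  have /negPf ev : e != v by apply: contraNneq vr => <-; rewrite inE er orbT.
  by rewrite /X' /Y' /augX /augY; case: (t); rewrite !inE ?eu ?ev.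
split; last first.
  move=> e er el; have [-> ->] := out e er; apply: mid; rewrite // inE er orbT //.
have lr : last u (y :: r) \in y :: r by rewrite /= mem_last.
by rewrite inE; have [-> ->] := out _ lr; move: lX; rewrite inE.
Qed.

End Certificate.

(** * Prim's algorithm and a cost-aware program logic *)

Section Prim.

Variables (R : realFieldType) (G : graph) (A : {set 'I_(ne G)}) (w : 'I_(ne G) -> R).
Variable (x0 : 'I_(nv G)).
Local Notation E := 'I_(ne G).
Local Notation V := 'I_(nv G).
Implicit Types (M : {set V}) (F : {set E}) (e : E) (i : nat).

Definition crossing M e := (e \in A) && (((ends e).1 \in M) != ((ends e).2 \in M)).

(** There are two uses: with all edges allowed a minimum tree is built, the concern of the last
    clause; with a tree less one edge a component is marked. The disjunction on [i] makes [nv G]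
    rounds sufficient, since its first alternative is then impossible. *)
Definition prim i M F : Prop :=
  [/\ x0 \in M /\ F \subset A,
      forall x, x \in M -> connect (adj F) x0 x,
      forall e, e \in F -> ((ends e).1 \in M) && ((ends e).2 \in M),
      #|F|.+1 = #|M| /\ ((i < #|M|)%N \/ forall e, ~~ crossing M e) &
      connected_graph G -> A = setT -> exists2 T, min_tree w T & F \subset T].

Lemma prim_init : prim 0 [set x0] set0.
Proof.
split.
- by rewrite set11 sub0set.
- by move=> x /set1P->.
- by move=> e; rewrite inE.
- by rewrite cards0 cards1; split=> //; left.
- by move=> /(min_tree_exists w)[T mT] _; exists T; rewrite ?sub0set.
Qed.

Lemma prim_stop i M F : prim i M F -> (forall e, ~~ crossing M e) -> prim i.+1 M F.
Proof. by case=> a b c [d _] e h; split=> //; split=> //; right. Qed.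

(** Cut property: if the tree containing [F] misses [b], its path between the ends of [b] crosses
    the boundary of [M] at some [f], outside [F] and no lighter than [b], which [b] replaces. Both
    ends of [b] are added to [M], so the new one need not be identified. *)
Lemma prim_step i M F b : prim i M F -> crossing M b ->
  (forall e, crossing M e -> w b <= w e) ->
  prim i.+1 ((ends b).1 |: ((ends b).2 |: M)) (b |: F).
Proof.
move=> [[xM FA] con inM [card ci] opt] cb minb.
have /andP[bA bM] := cb.
have bF : b \notin F by apply: contraNN bM => /inM /andP[-> ->].
have sub x y : connect (adj F) x y -> connect (adj (b |: F)) x y.
  exact/connect_subset/subsetUr.
have bb : connect (adj (b |: F)) (ends b).1 (ends b).2 by apply: connect_edge; rewrite setU11.
have cs := @adj_csym G (b |: F).
split.
- by rewrite !inE xM !orbT subUset sub1set bA.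
- have b12 : connect (adj (b |: F)) x0 (ends b).1 /\ connect (adj (b |: F)) x0 (ends b).2.
    move: bM; case: (boolP (_ \in M)) => [/con/sub h _|_].
      by split=> //; apply: connect_trans h bb.
    case: (boolP (_ \in M)) => // /con/sub h _; split=> //.
    by apply: connect_trans h _; rewrite cs.
  move=> x; rewrite !inE => /or3P[/eqP->|/eqP->|/con/sub//]; by case: b12.
- move=> e; rewrite !inE => /orP[/eqP->|/inM/andP[-> ->]]; first by rewrite !eqxx ?orbT.
  by rewrite !orbT.
- have cM : #|(ends b).1 |: ((ends b).2 |: M)| = #|M|.+1.
    move: bM; rewrite !cardsU1 !inE; case: (eqVneq (ends b).1 (ends b).2) => [->|_]; first by rewrite eqxx.
    by case: (_ \in M); case: (_ \in M).
  rewrite cM cardsU1 bF -card; split=> //; left; rewrite !ltnS.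
  case: ci => [|/(_ b)]; last by rewrite cb.
  by rewrite -card ltnS.
move=> cG AT; have [T mT FT] := opt cG AT.
case: (boolP (b \in T)) => bT; first by exists T; rewrite // subUset sub1set bT.
have [f [fT fM fb]] : exists f, [/\ f \in T, ((ends f).1 \in M) != ((ends f).2 \in M)
    & ~~ connect (adj (T :\ f)) (ends b).1 (ends b).2].
  have tT := min_tree_tree mT.
  move: bM; case: (boolP (_ \in M)) => b1; case: (boolP (_ \in M)) => // b2 _.
    exact: (tree_crossing (A := mem M)).
  have [f [h1 h2 h3]] := tree_crossing (A := mem M) tT b2 b1.
  by exists f; split=> //; rewrite adj_csym.
have tbf := tree_swap (min_tree_tree mT) fT fb.
exists (b |: T :\ f).
  rewrite (min_tree_swap mT) // tbf eq_le (min_tree_le mT fT bT tbf) andbT /=.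
  by apply: minb; rewrite /crossing AT inE.
rewrite subUset sub1set setU11 /=; apply/subsetP => e eF.
rewrite !inE (subsetP FT) // andbT; apply/orP; right.
by apply: contraNneq fM => <-; case/andP: (inM e eF) => -> ->.
Qed.

Lemma prim_closed M F : prim (nv G) M F -> forall e, ~~ crossing M e.
Proof.
case=> _ _ _ [_ [lt|//]] _; move: lt; rewrite ltnNge => /negP[].
by have := max_card (mem M); rewrite card_ord.
Qed.

Lemma prim_mark M F x : prim (nv G) M F -> (x \in M) = connect (adj A) x0 x.
Proof.
move=> pM; have cl := prim_closed pM; case: pM => [[xM FA] con _ _ _].
apply/idP/idP => [/con|]; first exact: connect_subset.
apply: contraTT => xnM; apply/negP => h.
have [e eA eM] := connect_cut (A := mem M) h xM xnM.
by have := cl e; rewrite /crossing eA eM.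
Qed.

(** [F] connects all vertices and lies in a minimum tree, of which an edge outside [F] could not be
    a bridge. The bound on [#|F|] later limits the number of phases. *)
Lemma prim_min_tree M F : prim (nv G) M F -> connected_graph G -> A = setT ->
  min_tree w F /\ (#|F| < nv G)%N.
Proof.
move=> pM cG AT; have mk x := prim_mark x pM; case: (pM) => [_ con _ [card _] opt].
split; last by rewrite card; have := max_card (mem M); rewrite card_ord.
have [T mT FT] := opt cG AT.
suff -> : F = T by [].
apply/eqP; rewrite eqEsubset FT; apply/subsetP => e eT; apply: contraT => eF.
have /is_treeP[_ /(_ e eT)/negP[]] := min_tree_tree mT.
have conF x : connect (adj F) x0 x.
  by apply: con; rewrite mk AT; case: cG.
have FTe : F \subset T :\ e.
  by apply/subsetP => f fF; rewrite !inE (subsetP FT) // andbT; apply: contraNneq eF => <-.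
apply: (connect_subset FTe); apply: connect_trans (conF _).
by rewrite adj_csym.
Qed.

End Prim.

(** * Timed runs of programs: rules for straight-line code and loops *)

Section Runs.

Variable R : realFieldType.
Implicit Types (p : cmd) (s : state R) (Q : state R -> Prop).

Definition runs p s (T : nat) Q : Prop :=
  exists t s', [/\ exec p s t s', (t <= T)%N & Q s'].

Lemma runs_weaken p s T T' Q Q' : runs p s T Q -> (T <= T')%N ->
  (forall s', Q s' -> Q' s') -> runs p s T' Q'.
Proof.
move=> [t [s' [ex tT Qs]]] TT h; exists t, s'; split=> //; last exact: h.
exact: leq_trans tT TT.
Qed.

Lemma runs_seq p q s T1 T2 Q :
  runs p s T1 (fun s' => runs q s' T2 Q) -> runs (Seq p q) s (T1 + T2) Q.
Proof.
move=> [t [s' [ex tT [t' [s'' [ex' tT' Qs]]]]]]; exists (t + t')%N, s''; split=> //.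
  exact: exec_seq ex ex'.
exact: leq_add.
Qed.

Fixpoint straight p : bool :=
  match p with
  | Seq p q | If _ p q => straight p && straight q
  | While _ _ => false
  | _ => true
  end.

(** Symbolic execution, so that the effect of loop-free code is found by computation; the value on
    [While] is a dummy ruled out by [straight]. *)
Fixpoint run p s : state R :=
  match p with
  | Skip | While _ _ => s
  | ISet a i e => State (upd (imem s) a (ieval s i) (ieval s e)) (rmem s)
  | RSet a i e => State (imem s) (upd (rmem s) a (ieval s i) (reval s e))
  | Seq p q => run q (run p s)
  | If b p q => if beval s b then run p s else run q s
  end.

(* Both branches of a conditional are charged. *)
Fixpoint ctime p : nat :=
  match p with
  | Skip | While _ _ => 1
  | ISet a i e => (itime i + itime e).+1
  | RSet a i e => (itime i + rtime e).+1
  | Seq p q => ctime p + ctime q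
  | If b p q => (btime b + (ctime p + ctime q)).+1
  end.

Lemma runs_straight p s T Q : straight p -> (ctime p <= T)%N -> Q (run p s) -> runs p s T Q.
Proof.
suff h : straight p -> exists2 t, exec p s t (run p s) & (t <= ctime p)%N.
  by move=> /h[t ex tp] pT Qs; exists t, (run p s); split=> //; apply: leq_trans pT.
elim: p s {Q} => //=.
- by move=> s _; exists 1%N => //; constructor.
- by move=> a i e s _; exists (itime i + itime e).+1 => //; constructor.
- by move=> a i e s _; exists (itime i + rtime e).+1 => //; constructor.
- move=> p IHp q IHq s /andP[/(IHp s)[t ex tp] /(IHq (run p s))[t' ex' tq]].
  by exists (t + t')%N; [apply: exec_seq ex ex' | apply: leq_add].
move=> b p IHp q IHq s /andP[/(IHp s)[t ex tp] /(IHq s)[t' ex' tq]].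
case: ifP => bs.
  exists (btime b + t).+1; last by rewrite ltnS leq_add2l (leq_trans tp) ?leq_addr.
  by apply: exec_if; rewrite bs.
exists (btime b + t').+1; last by rewrite ltnS leq_add2l (leq_trans tq) ?leq_addl.
by apply: exec_if; rewrite bs.
Qed.

Lemma runs_if b p q s T Q :
  runs (if beval s b then p else q) s T Q -> runs (If b p q) s (btime b + T).+1 Q.
Proof.
move=> [t [s' [ex tT Qs]]]; exists (btime b + t).+1, s'; split=> //.
  exact: exec_if.
by rewrite ltnS leq_add2l.
Qed.

(** The index of [I] is a variant bounding the number of remaining rounds; it may drop by more than
    one, and the loop may stop before it reaches 0. *)
Lemma runs_while b p s (I : nat -> state R -> Prop) N tb Q T : I N s ->
  (forall j s, I j s -> beval s b ->
     (0 < j)%N /\ runs p s tb (fun s' => exists2 j', (j' < j)%N & I j' s')) ->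
  (forall j s, I j s -> ~~ beval s b -> Q s) ->
  (N * (btime b + tb).+1 + (btime b).+1 <= T)%N ->
  runs (While b p) s T Q.
Proof.
move=> IN body post; elim/ltn_ind: N s T IN => N IHN s T IN le_T.
case: (boolP (beval s b)) => bs; last first.
  exists (btime b).+1, s; split; [exact: exec_while_done| |exact: post IN bs].
  by apply: leq_trans le_T; rewrite leq_addl.
have [N0 [t [s' [ex tt [j' lt Ij']]]]] := body _ _ IN bs.
have [t' [s'' [ex' tt' Qs]]] := IHN j' lt s' _ Ij' (leqnn _).
exists (btime b + t + t').+1, s''; split=> //; first exact: exec_while_step ex ex'.
apply: leq_trans le_T; move: tt tt' lt; move: (btime b) => B.
move=> tt tt' lt; have := leq_mul lt (leqnn (B + tb).+1); rewrite mulSn.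
by move: (j' * _)%N (N * _)%N tt' => x y; lia.
Qed.

Definition getv x := IGet x (INum 0).
Definition setv x e := ISet x (INum 0) e.
Definition Lt e1 e2 := BNot (BIle e2 e1).
(** The bound is read from cell [j] of the input array 0: [j = 0] runs over vertices, [j = 1] over
    edges. *)
Definition For x j p := Seq (setv x (INum 0))
  (While (Lt (getv x) (IGet 0 (INum j))) (Seq p (setv x (IAdd (getv x) (INum 1))))).

Definition setvar s x v := State (upd (imem s) x 0 v) (rmem s).

Lemma runs_for x j p s (I : nat -> state R -> Prop) N M tb Q T :
  (N <= M)%N -> (0 < M)%N ->
  I 0%N s ->
  (forall i s v, I i s -> I i (setvar s x v)) ->
  (forall i s, I i s -> imem s 0 j = N) ->
  (forall i s, (i < N)%N -> imem s x 0 = i -> I i s ->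
     runs p s tb (fun s' => imem s' x 0 = i /\ I i.+1 s')) ->
  (forall s, I N s -> Q s) ->
  (M * (tb + 23) <= T)%N ->
  runs (For x j p) s T Q.
Proof.
move=> NM M0 I0 Ix Ij body post le_T.
(* Resetting the counter costs 3, a round costs 6 for the guard, 6 for the increment and 1 for the
   loop, and the failing guard costs 7. Charged to [M] rounds, at least one, this gives 23. *)
have : runs (For x j p) s (3 + (N * (6 + (tb + 6)).+1 + 7))%N Q; last first.
  move=> h; apply: runs_weaken h _ (fun _ h => h); apply: leq_trans le_T; nia.
apply: runs_seq; apply: runs_straight => //=.
rewrite -/(setvar s x 0).
apply: (runs_while (I := fun k s => exists i, [/\ (k + i = N)%N, imem s x 0 = i & I i s])
  (N := N) (tb := (tb + 6)%N)).
- by exists 0%N; split=> //; [rewrite addn0 | rewrite /= /upd !eqxx | apply: Ix].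
- move=> k s1 [i [kN xi Ii]]; rewrite /= xi (Ij _ _ Ii) -ltnNge => lt.
  split; first by lia.
  apply: runs_seq; apply: runs_weaken (body i s1 lt xi Ii) _ _ => // s2 [xi2 I2].
  apply: runs_straight => //=; exists k.-1; first by lia.
  exists i.+1; rewrite -/(setvar s2 x _); split; [lia| |exact: Ix].
  by rewrite /= /upd !eqxx /= xi2 addn1.
- move=> k s1 [i [kN xi Ii]]; rewrite /= xi (Ij _ _ Ii) negbK => le.
  by apply: post; have <- : i = N by lia.
by [].
Qed.

End Runs.

(** * Frame conditions *)

Section Agree.

Variable R : realFieldType.
Implicit Types (s : state R) (li lr : seq nat).

(** The granularity is that of whole arrays, so every scalar of the program has an array of its
    own. *)
Definition agree li lr s s' : Prop :=
  (forall a i, a \notin li -> imem s' a i = imem s a i) /\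
  (forall a i, a \notin lr -> rmem s' a i = rmem s a i).

Lemma agree_trans li lr s1 s2 s3 :
  agree li lr s1 s2 -> agree li lr s2 s3 -> agree li lr s1 s3.
Proof.
move=> [h1 h2] [h3 h4]; split=> a i ia; first by rewrite h3 // h1.
by rewrite h4 // h2.
Qed.

Lemma agree_sub li lr li' lr' s s' : {subset li <= li'} -> {subset lr <= lr'} ->
  agree li lr s s' -> agree li' lr' s s'.
Proof.
move=> hi hr [h1 h2]; split=> a i na; [apply: h1|apply: h2]; apply: contra na.
  exact: hi.
exact: hr.
Qed.

Lemma agree_seti li lr s f r a i v : a \in li -> agree li lr s (State f r) ->
  agree li lr s (State (upd f a i v) r).
Proof.
move=> al [h1 h2]; split=> // b j bl /=; rewrite -h1 //= /upd.
by case: eqP => [ba|//]; rewrite -ba (negPf bl) in al.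
Qed.

Lemma agree_setr li lr s f r a i v : a \in lr -> agree li lr s (State f r) ->
  agree li lr s (State f (upd r a i v)).
Proof.
move=> al [h1 h2]; split=> // b j bl /=; rewrite -h2 //= /upd.
by case: eqP => [ba|//]; rewrite -ba (negPf bl) in al.
Qed.

Lemma updE (T : Type) (f : nat -> nat -> T) a i v a' i' :
  upd f a i v a' i' = if (a' == a) && (i' == i) then v else f a' i'.
Proof. by []. Qed.

Lemma runs_fill a j e s N M (f : nat -> nat) Q T :
  (N <= M)%N -> (0 < M)%N -> imem s 0 j = N -> a != 0%N -> a != 9%N ->
  (forall s' i, (i < N)%N -> agree [:: 9; a]%N [::] s s' -> imem s' 9 0 = i ->
     ieval s' e = f i) ->
  (forall s', agree [:: 9; a]%N [::] s s' ->
     (forall i, (i < N)%N -> imem s' a i = f i) -> Q s') ->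
  (M * (itime e + 27) <= T)%N ->
  runs (For 9 j (ISet a (getv 9) e)) s T Q.
Proof.
move=> NM M0 sj a0 a9 ev post le_T.
have n0 : 0%N \notin [:: 9%N; a] by rewrite !inE /= eq_sym.
apply: (runs_for (N := N) (M := M) (tb := (itime e + 4)%N) (I := fun i s' =>
  agree [:: 9; a]%N [::] s s' /\ forall i', (i' < i)%N -> imem s' a i' = f i')) => //.
- move=> i s1 v [ag h]; split; first exact: agree_seti.
  by move=> i' lt; rewrite /= updE (negPf a9) h.
- by move=> i s1 [[h _] _]; rewrite h.
- move=> i s1 lt xi [ag h]; apply: runs_straight => //=; first by lia.
  split; first by rewrite updE eq_sym (negPf a9).
  split; first by apply: agree_seti => //; rewrite !inE eqxx orbT.
  move=> i'; rewrite ltnS leq_eqVlt updE eqxx xi /= (ev s1 i) //.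
  by case: eqP => [->//|_]; apply: h.
- by move=> s1 [ag h]; apply: post.
by rewrite -addnA in le_T *.
Qed.

End Agree.

(* Arrays of the program, besides those of the input and output (sets are stored
   as 0/1 arrays; 8-11 and 18-22 are scalars, in cell 0).  Integers: 5 vertices
   reached by Prim, 6 edges Prim may use, 7 edges picked by Prim, 8 result of
   [argmin], 9-11 loop variables and current nodes, 12 row offsets u * m of the
   exchange matrices 13 (X) and 14 (Y), 15 search set, 16 parents, 17 types of the
   parent arcs (1 for X, 0 for Y), 18 sink found, 19 |Y \ X|, 20 node of the
   backward walk, 21 root for Prim, 22 running row offset.  Reals: 2 al, 3 least
   known slack, 4 scratch, 5 weights for Prim.  Where 0 means "none", an index is
   stored with offset one. *)
Definition inside a e := BIle (INum 1) (IGet a e).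
Definition bSame e1 e2 := BAnd (BIle e1 e2) (BIle e2 e1).
Definition pred1e e := ISub e (INum 1).
Definition succe e := IAdd e (INum 1).

(** * Programs for minimum search and Prim's algorithm *)

Definition argmin_body (cond : bexp) (w : nat) :=
  If cond
    (If (BAnd (Lt (INum 0) (getv 8))
              (BRle (RGet w (pred1e (getv 8))) (RGet w (getv 9))))
        Skip (setv 8 (succe (getv 9)))) Skip.
Definition argmin cond w := Seq (setv 8 (INum 0)) (For 9 1 (argmin_body cond w)).
Definition argminK cond w := (ctime (argmin_body cond w) + 26)%N.

Lemma argmin_runs (R : realFieldType) (m M : nat) cond w (s : state R) (P : pred 'I_m) Q T :
  (m <= M)%N -> (0 < M)%N -> imem s 0 1 = m ->
  (forall s' (e : 'I_m), agree [:: 8; 9]%N [::] s s' -> imem s' 9 0 = e ->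
     beval s' cond = P e) ->
  (forall s', agree [:: 8; 9]%N [::] s s' ->
     (imem s' 8 0 = 0%N /\ forall e, ~~ P e) \/
     (exists b : 'I_m, [/\ imem s' 8 0 = b.+1, P b &
        forall e, P e -> rmem s w b <= rmem s w e]) -> Q s') ->
  (M * argminK cond w <= T)%N ->
  runs (argmin cond w) s T Q.
Proof.
move=> mM M0 s1 ev post le_T.
have : runs (argmin cond w) s (3 + M * (ctime (argmin_body cond w) + 23)) Q; last first.
  move=> h; apply: runs_weaken h _ (fun _ h => h); apply: leq_trans le_T.
  by rewrite /argminK; nia.
apply: runs_seq; apply: runs_straight => //=.
apply: (runs_for (N := m) (M := M) (tb := ctime (argmin_body cond w)) (I := fun i s' =>
  agree [:: 8; 9]%N [::] s s' /\
  ((imem s' 8 0 = 0%N /\ forall e : 'I_m, (e < i)%N -> ~~ P e) \/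
     (exists b : 'I_m, [/\ imem s' 8 0 = b.+1, P b &
        forall e : 'I_m, (e < i)%N -> P e -> rmem s w b <= rmem s w e])))) => //.
- split; first exact: agree_seti.
  by left; split.
- by move=> i s' v [ag h]; split; first exact: agree_seti.
- by move=> i s' [[h _] _]; rewrite h.
- move=> i s' lt xi [ag h]; apply: runs_straight => //=.
  have beq := ev s' (Ordinal lt) ag xi; rewrite beq.
  have rw b : rmem s' w b = rmem s w b by case: ag => _ ->.
  have ltS (e : 'I_m) : (e < i.+1)%N -> e = Ordinal lt \/ (e < i)%N.
    rewrite ltnS leq_eqVlt => /orP[/eqP ei|]; [left|by right].
    exact/val_inj.
  case: ifP => Pi; last first.
    split=> //; split=> //; case: h => [[h1 h2]|[b [h1 h2 h3]]]; [left|right].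
      by split=> // e /ltS[->|/h2//]; rewrite Pi.
    by exists b; split=> // e /ltS[->|/h3//]; rewrite Pi.
  rewrite /getv /= xi !rw.
  case: h => [[h1 h2]|[b [h1 h2 h3]]]; rewrite h1 /=.
    split; first by rewrite ?updE.
    split; first exact: agree_seti.
    right; exists (Ordinal lt); split=> //; first by rewrite ?updE /= addn1.
    by move=> e /ltS[-> //|/h2 /negPf->].
  rewrite subn1 /=; case: (leP (rmem s w b) (rmem s w i)) => [le|gt].
    split=> //; split=> //; right; exists b; split=> // e /ltS[-> //|]; exact: h3.
  split; first by rewrite ?updE.
  split; first exact: agree_seti.
  right; exists (Ordinal lt); split=> //; first by rewrite ?updE /= addn1.
  by move=> e /ltS[-> //|/h3 h Pe]; apply: le_trans (ltW gt) (h Pe).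
- move=> s' [ag h]; apply: post => //; case: h => [[h1 h2]|[b [h1 h2 h3]]]; [left|right].
    by split=> // e; apply: h2.
  by exists b; split=> // e; apply: h3.
Qed.

Definition marked_apart := BNot (bSame (IGet 5 (IGet 1 (getv 9))) (IGet 5 (IGet 2 (getv 9)))).
Definition grow_cond := BAnd (inside 6 (getv 9)) marked_apart.
Definition best := pred1e (getv 8).
Definition grow_add := If (Lt (INum 0) (getv 8))
  (Seq (ISet 7 best (INum 1))
  (Seq (ISet 5 (IGet 1 best) (INum 1)) (ISet 5 (IGet 2 best) (INum 1)))) Skip.
Definition grow :=
  Seq (For 9 0 (ISet 5 (getv 9) (INum 0)))
 (Seq (For 9 1 (ISet 7 (getv 9) (INum 0)))
 (Seq (ISet 5 (getv 21) (INum 1))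
      (For 10 0 (Seq (argmin grow_cond 5) grow_add)))).
Definition growK := (argminK grow_cond 5 + ctime grow_add + 100)%N.

Section Grow.

Variables (R : realFieldType) (G : graph).
Implicit Types (s : state R).

Definition has_graph s : Prop :=
  [/\ imem s 0 0 = nv G, imem s 0 1 = ne G,
      forall e : 'I_(ne G), imem s 1 e = (ends e).1 &
      forall e : 'I_(ne G), imem s 2 e = (ends e).2].

Lemma has_graph_agree li lr s s' : 0%N \notin li -> 1%N \notin li -> 2%N \notin li ->
  agree li lr s s' -> has_graph s -> has_graph s'.
Proof.
by move=> l0 l1 l2 [h _] [g1 g2 g3 g4]; split; [rewrite h|rewrite h|move=> e; rewrite h..].
Qed.

Definition holds_set n s a (A : {set 'I_n}) : Prop :=
  forall e : 'I_n, imem s a e = (e \in A).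

Lemma holds_set_agree n li lr s s' a (A : {set 'I_n}) : a \notin li ->
  agree li lr s s' -> holds_set s a A -> holds_set s' a A.
Proof. by move=> la [h _] sA e; rewrite h. Qed.

Lemma holds_set_add n f r a (A : {set 'I_n}) (i : 'I_n) j : holds_set (State f r) a A -> j = i :> nat ->
  holds_set (State (upd f a j 1%N) r : state R) a (i |: A).
Proof.
move=> sA -> e; have /= sAe := sA e; rewrite updE eqxx !inE sAe -val_eqE /=.
by case: eqP.
Qed.

Lemma holds_set_del n f r a (A : {set 'I_n}) (i : 'I_n) j : holds_set (State f r) a A -> j = i :> nat ->
  holds_set (State (upd f a j 0%N) r : state R) a (A :\ i).
Proof.
move=> sA -> e; have /= sAe := sA e; rewrite updE eqxx !inE sAe -val_eqE /=.
by case: eqP.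
Qed.

Lemma marked_apartE s' (M : {set 'I_(nv G)}) (e : 'I_(ne G)) : has_graph s' ->
  holds_set s' 5 M -> imem s' 9 0 = e ->
  beval s' marked_apart = (((ends e).1 \in M) != ((ends e).2 \in M)).
Proof.
move=> [_ _ g1 g2] sM x; rewrite /= x g1 g2 !sM.
by case: (_ \in M); case: (_ \in M).
Qed.

(** The loop always makes [nv G] rounds, each scanning all edges; once no crossing edge is left, the
    remaining rounds change nothing, by [prim_stop]. *)
Lemma grow_runs s (A : {set 'I_(ne G)}) (x0 : 'I_(nv G)) M Q T :
  has_graph s -> (ne G <= M)%N -> (0 < M)%N -> (0 < nv G)%N ->
  holds_set s 6 A -> imem s 21 0 = x0 ->
  (forall s' V F, agree [:: 5; 7; 8; 9; 10]%N [::] s s' ->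
     prim A (fun e => rmem s 5 e) x0 (nv G) V F ->
     holds_set s' 5 V -> holds_set s' 7 F -> Q s') ->
  (growK * (nv G * M) <= T)%N ->
  runs grow s T Q.
Proof.
move=> hg mM M0 n0 sA sx post le_T; have [gn gm g1 g2] := hg.
set w := fun e => rmem s 5 e in post.
have : runs grow s (nv G * (1 + 27) + (M * (1 + 27) + (4 + nv G * (M * argminK grow_cond 5 + ctime grow_add + 23)))) Q; last first.
  move=> h; apply: runs_weaken h _ (fun _ h => h); apply: leq_trans le_T.
  rewrite /growK; move: (argminK _ _) (ctime _) (nv G) n0 => a b n n0.
  have h1 : (n <= n * M)%N by apply: leq_pmulr.
  have h2 : (M <= n * M)%N by apply: leq_pmull.
  have h3 := leq_mul h1 (leqnn (b + 60)); lia.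
apply: runs_seq; apply: (runs_fill (N := nv G) (M := nv G) (f := fun=> 0%N)) => //.
move=> s1 ag1 mk1; apply: runs_seq.
have hg1 : has_graph s1 by apply: has_graph_agree ag1 hg.
apply: (runs_fill (N := ne G) (M := M) (f := fun=> 0%N)) => //; first by case: hg1.
move=> s2 ag2 f2; apply: runs_seq; apply: runs_straight => //.
set s3 := run _ s2.
have ag : agree [:: 5; 7; 8; 9; 10]%N [::] s s3.
  apply: agree_seti => //; apply: agree_trans (agree_sub _ _ ag1) (agree_sub _ _ ag2) => //.
    by apply/allP.
  by apply/allP.
have V3 : holds_set s3 5 [set x0].
  move=> x; rewrite /= ?updE /= (proj1 ag2) // (proj1 ag1) // sx !inE -val_eqE /=.
  by rewrite (proj1 ag2) // mk1 //; case: eqP.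
have F3 : holds_set s3 7 (@set0 'I_(ne G)).
  by move=> e; rewrite /= ?updE /= f2 // inE.
apply: (runs_for (N := nv G) (M := nv G)
  (tb := (M * argminK grow_cond 5 + ctime grow_add)%N) (I := fun i s' =>
  agree [:: 5; 7; 8; 9; 10]%N [::] s s' /\ exists V F, [/\ prim A w x0 i V F,
    holds_set s' 5 V & holds_set s' 7 F])) => //.
- split=> //; exists [set x0], set0; split=> //; exact: prim_init.
- by move=> i s' v [ag' h]; split; first exact: agree_seti.
- by move=> i s' [[-> //]].
- move=> i s' _ xi [ag' [V [F [pr sV sF]]]]; apply: runs_seq.
  have hg' : has_graph s' by apply: has_graph_agree ag' hg.
  have rw e : rmem s' 5 e = rmem s 5 e by case: ag' => _ ->.
  have sA' : holds_set s' 6 A by apply: holds_set_agree ag' sA.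
  apply: (argmin_runs (m := ne G) (P := crossing A V) (M := M)) => //.
  + by case: hg'.
  + move=> s4 e ag4 x4; 
    have -> : beval s4 grow_cond = (0 < imem s4 6 (imem s4 9 0))%N && beval s4 marked_apart.
      by [].
    rewrite (@marked_apartE s4 V e) //.
    * by rewrite x4 (holds_set_agree _ ag4 sA') // lt0b.
    * exact: has_graph_agree ag4 hg'.
    * exact: holds_set_agree ag4 sV.
  move=> s4 ag4 best4.
  have sV4 : holds_set s4 5 V by apply: holds_set_agree ag4 sV.
  have sF4 : holds_set s4 7 F by apply: holds_set_agree ag4 sF.
  have [gn4 gm4 g14 g24] : has_graph s4 by apply: has_graph_agree ag4 hg'.
  have ags4 : agree [:: 5; 7; 8; 9; 10]%N [::] s s4.
    by apply: agree_trans ag' (agree_sub _ _ ag4) => //; apply/allP.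
  apply: runs_straight => //=.
  have x10 : imem s4 10 0 = i by rewrite (proj1 ag4).
  case: best4 => [[b0 cl]|[b [b4 Pb minb]]].
    rewrite b0 /=; split=> //; split=> //; exists V, F; split=> //; exact: prim_stop.
  rewrite b4 /= !updE /= b4 subn1 /=; split=> //.
  split; first by do !apply: agree_seti => //.
  exists ((ends b).1 |: ((ends b).2 |: V)), (b |: F); split.
  + by apply: prim_step => // e /minb; rewrite !rw.
  + rewrite setUCA.
    apply: holds_set_add; last by rewrite g24.
    apply: holds_set_add; last by rewrite g14.
    by move=> x; rewrite /= updE /= sV4.
  + move=> e; rewrite /= ?updE /=.
    exact: (holds_set_add (f := imem s4) (r := rmem s4) (i := b) sF4 erefl e).
- by move=> s' [ag' [V [F [pr sV sF]]]]; apply: post pr sV sF.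
Qed.

End Grow.

(** * Exchange matrices *)

(** The language has no multiplication, so the row offset is looked up in a table filled by repeated
    addition. *)
Definition address := IAdd (IGet 12 (getv 11)) (getv 9).
(* Row u: after Prim has marked the component of one end of u in T - u, the edges
   leaving it are those that can replace u. *)
Definition exch_entry T A :=
  If (BAnd (inside T (getv 11)) (BAnd (BNot (inside T (getv 9))) marked_apart))
     (ISet A address (INum 1)) (ISet A address (INum 0)).
Definition exch_row T A :=
  Seq (For 9 1 (ISet 6 (getv 9) (IGet T (getv 9))))
 (Seq (Seq (ISet 6 (getv 11) (INum 0)) (setv 21 (IGet 1 (getv 11))))
 (Seq grow (For 9 1 (exch_entry T A)))).
Definition exch T A := For 11 1 (exch_row T A).
Definition exchK := (growK + ctime (exch_entry 3 13) + 100)%N.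

Lemma run_if (R : realFieldType) b p q (s : state R) :
  run (If b p q) s = if beval s b then run p s else run q s.
Proof. by []. Qed.

Lemma run_seq (R : realFieldType) p q (s : state R) : run (Seq p q) s = run q (run p s).
Proof. by []. Qed.

Section Exchanges.

Variables (R : realFieldType) (G : graph).
Implicit Types (s : state R) (X : {set 'I_(ne G)}).

Definition exchanges X (u v : 'I_(ne G)) := [&& u \in X, v \notin X & is_tree (v |: X :\ u)].

Definition holds_base s : Prop := forall u : 'I_(ne G), imem s 12 u = (u * ne G)%N.

Definition holds_exchanges s A X : Prop :=
  forall u v : 'I_(ne G), imem s A (u * ne G + v) = exchanges X u v.

Lemma address_inj m (u v u' v' : 'I_m) :
  (u * m + v == u' * m + v')%N = (u == u') && (v == v').
Proof.
have m0 : (0 < m)%N by apply: leq_ltn_trans (ltn_ord u).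
apply/eqP/andP => [e|[/eqP-> /eqP->] //].
have := congr1 (divn ^~ m) e; have := congr1 (modn ^~ m) e => /=.
rewrite !modnMDl !divnMDl // !modn_small // !divn_small // !addn0.
by move=> /val_inj-> /val_inj->.
Qed.

(** Prim is run on [X :\ u] for every edge [u], in [X] or not: [ne G] runs of cost proportional to
    [nv G * M], the dominant term of the whole bound. The membership test makes the row of an edge
    outside [X] zero. *)
Lemma exch_runs s X T A M Q t : (T, A) \in [:: (3, 13); (4, 14)]%N ->
  has_graph G s -> (ne G <= M)%N -> (0 < M)%N -> (0 < nv G)%N ->
  holds_set s T X -> is_tree X -> holds_base s ->
  (forall s', agree [:: A; 5; 6; 7; 8; 9; 10; 11; 21]%N [::] s s' ->
     holds_exchanges s' A X -> Q s') ->
  (exchK * (M * (nv G * M)) <= t)%N ->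
  runs (exch T A) s t Q.
Proof.
move=> TA hg mM M0 n0 sX tX sb post le_t.
have TA' : (T = 3 /\ A = 13) \/ (T = 4 /\ A = 14).
  by move: TA; rewrite !inE => /orP[] /eqP[-> ->]; [left|right].
set L := [:: A; 5; 6; 7; 8; 9; 10; 11; 21]%N in post *.
have /and5P[L0 L1 L2 L12 TL] : [&& 0 \notin L, 1 \notin L, 2 \notin L, 12 \notin L & T \notin L]%N.
  by rewrite /L; case: TA' => -[-> ->].
have hgL s' : agree L [::] s s' -> has_graph G s'.
  by move=> ag; apply: has_graph_agree ag hg.
have bL s' : agree L [::] s s' -> holds_base s'.
  by move=> [ag _] u; rewrite ag.
have AL : A \in L by rewrite mem_head.
apply: (runs_for (N := ne G) (M := M) (tb := (M * (3 + 27) + (9 + (growK * (nv G * M) + M * (ctime (exch_entry 3 13) + 23))))%N)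
  (I := fun i s' => agree L [::] s s' /\
     forall u v : 'I_(ne G), (u < i)%N -> imem s' A (u * ne G + v) = exchanges X u v)) => //.
- move=> i s' v [ag h]; split; first by apply: agree_seti => //; rewrite !inE eqxx !orbT.
  move=> u v' ui; rewrite /= updE; case: TA' => -[_ AE]; rewrite AE /=; rewrite -AE; exact: h.
- by move=> i s' [/hgL[]].
- move=> i s' lt xi [ag h]; set u := Ordinal lt.
  have [g0 gm g1 g2] := hgL _ ag.
  have sX' : holds_set s' T X by apply: holds_set_agree ag sX.
  apply: runs_seq; apply: (runs_fill (N := ne G) (M := M) (f := fun j => imem s' T j)) => //.
    by move=> s1 j _ [ag1 _] /= ->; rewrite ag1 //; case: TA' => -[-> _].
  move=> s1 ag1 s1T; apply: runs_seq; apply: runs_straight => //; set s2 := run _ s1.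
  have Ls1 : agree L [::] s s1.
    apply: agree_trans ag (agree_sub _ _ ag1) => // z; rewrite !inE => /orP[] /eqP->;
    by rewrite !eqxx ?orbT.
  have x11 : imem s1 11 0 = u by rewrite (proj1 ag1).
  have Ls2 : agree L [::] s s2.
    by do ?apply: agree_seti => //; rewrite !inE eqxx ?orbT.
  have s26 : holds_set s2 6 (X :\ u).
    move=> e; rewrite /s2 /= !updE /= x11 /= s1T // sX' !inE -val_eqE /=.
    by case: eqP.
  have s221 : imem s2 21 0 = (ends u).1.
    rewrite /s2 /= !updE /= x11; case: (hgL _ Ls1) => _ _ -> //.
  have x112 : imem s2 11 0 = u by rewrite /s2 /= !updE.
  apply: runs_seq; apply: (grow_runs (A := X :\ u) (x0 := (ends u).1) (M := M)) => //.
    exact: hgL.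
  move=> s3 V F ag3 pr sV _.
  have Ls3 : agree L [::] s s3.
    apply: agree_trans Ls2 (agree_sub _ _ ag3) => // z.
    by rewrite !inE => /or4P[||| /orP[]] /eqP->; rewrite !eqxx ?orbT.
  have x113 : imem s3 11 0 = u by rewrite (proj1 ag3).
  have h3 (w v : 'I_(ne G)) : (w < i)%N -> imem s3 A (w * ne G + v) = exchanges X w v.
    move=> wi; rewrite (proj1 ag3); last by case: TA' => -[_ ->].
    rewrite /s2 /= !updE; have := h w v wi; rewrite -(proj1 ag1); last by case: TA' => -[_ ->].
    by case: TA' => -[_ ->].
  have sX3 : holds_set s3 T X by apply: holds_set_agree Ls3 sX.
  have A911 : (9%N == A = false) * (11%N == A = false) by case: TA' => -[_ ->].
  apply: (runs_for (N := ne G) (M := M) (tb := ctime (exch_entry 3 13)) (I := fun j s4 =>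
      [/\ agree [:: 9; A]%N [::] s3 s4,
      forall w v : 'I_(ne G), (w < i)%N -> imem s4 A (w * ne G + v) = exchanges X w v &
      forall v : 'I_(ne G), (v < j)%N -> imem s4 A (u * ne G + v) = exchanges X u v])) => //.
  + move=> j s4 v [ag4 h4 h5]; split.
    * exact: agree_seti.
    * by move=> w v' wi; rewrite /= updE eq_sym A911 h4.
    * by move=> v' vj; rewrite /= updE eq_sym A911 h5.
  + move=> j s4 [ag4 _ _]; rewrite (proj1 ag4); last by case: TA' => -[_ ->].
    by case: (hgL _ Ls3).
  + move=> j s4 ltj x9 [ag4 h4 h5]; apply: runs_straight => //; set v := Ordinal ltj.
    have TA4 : T \notin [:: 9; A]%N by case: TA' => -[-> ->].
    have hg4 : has_graph G s4.
      by apply: has_graph_agree ag4 (hgL _ Ls3); case: TA' => -[_ ->].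
    have sX4 : holds_set s4 T X by apply: holds_set_agree ag4 sX3.
    have sV4 : holds_set s4 5 V.
      by apply: holds_set_agree ag4 sV; case: TA' => -[_ ->].
    have x114 : imem s4 11 0 = u.
      by rewrite (proj1 ag4) //; case: TA' => -[_ ->].
    have cE : beval s4 (BAnd (inside T (getv 11)) (BAnd (BNot (inside T (getv 9))) marked_apart))
        = exchanges X u v.
      have -> : beval s4 (BAnd (inside T (getv 11)) (BAnd (BNot (inside T (getv 9))) marked_apart))
        = [&& (0 < imem s4 T (imem s4 11 0))%N, ~~ (0 < imem s4 T (imem s4 9 0))%N
            & beval s4 marked_apart] by [].
      rewrite (@marked_apartE _ G s4 V v) // x9 x114 (sX4 u) (sX4 v) !lt0b /exchanges.
      case: (boolP (u \in X)) => //= uX; case: (boolP (v \in X)) => //= vX.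
      by rewrite (tree_swap_mark tX) // !(prim_mark _ pr).
    have adr : ieval s4 address = (u * ne G + v)%N.
      rewrite /= x9 x114 (_ : imem s4 12 u = u * ne G)%N //.
      rewrite (proj1 ag4); last by case: TA' => -[_ ->].
      exact: bL.
    have -> : run (exch_entry T A) s4 =
        State (upd (imem s4) A (u * ne G + v)%N (exchanges X u v)) (rmem s4).
      rewrite -adr /exch_entry run_if cE.
      by case: exchanges.
    split; first by rewrite /= updE A911.
    have idx (w v' : 'I_(ne G)) : imem (State (upd (imem s4) A (u * ne G + v)%N (exchanges X u v)) (rmem s4))
        A (w * ne G + v') = if (w == u) && (v' == v) then exchanges X u v : nat
                            else imem s4 A (w * ne G + v').
      by rewrite -address_inj /= updE eqxx.
    split.
    * by apply: agree_seti => //; rewrite !inE eqxx orbT.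
    * move=> w v' wi; rewrite idx h4 //; case: ifP => // /andP[/eqP wu].
      by rewrite wu ltnn in wi.
    * move=> v'; rewrite ltnS leq_eqVlt idx eqxx /= => /orP[/eqP vj|/h5->].
        by have -> : v' = v by [apply: val_inj]; rewrite eqxx.
      by case: eqP => [->|].
  move=> s4 [ag4 h4 h5]; split.
    rewrite (proj1 ag4); last by case: TA' => -[_ ->].
    by rewrite x113.
  split.
    apply: agree_trans Ls3 (agree_sub _ _ ag4) => // z.
    by rewrite !inE => /orP[] /eqP->; rewrite !eqxx ?orbT.
  move=> w v; rewrite ltnS leq_eqVlt => /orP[/eqP wi|]; last exact: h4.
  have -> : w = u by apply: val_inj.
  exact: h5.
- by move=> s' [ag h]; apply: post => // u v; apply: h.
apply: leq_trans le_t; rewrite [leqRHS]mulnCA leq_mul2l; apply/orP; right.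
rewrite /exchK; move: growK (ctime _) (nv G) n0 => a b n n0.
have h1 : (M <= n * M)%N by apply: leq_pmull.
have h2 : (0 < n * M)%N by rewrite muln_gt0 n0.
have h3 := leq_mul h1 (leqnn (b + 60)); lia.
Qed.

End Exchanges.

(** * The shortest path search *)

Definition relax_arc (cond : bexp) (len : rexp) (t : nat) :=
  If cond
    (Seq (RSet 4 (INum 0) len)
      (If (BAnd (inside 16 (getv 9)) (BRle (RGet 3 (getv 9)) (RGet 4 (INum 0)))) Skip
        (Seq (RSet 3 (getv 9) (RGet 4 (INum 0)))
        (Seq (ISet 16 (getv 9) (succe (getv 11))) (ISet 17 (getv 9) (INum t))))))
    Skip.
Definition arcX := inside 13 address.
(** The matrix is read transposed, since an arc u -> v of this type removes v from [Y] and inserts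
    u. *)
Definition arcY := inside 14 (IAdd (IGet 12 (getv 9)) (getv 11)).
Definition slackX :=
  RSub (RSub (RGet 0 (getv 9)) (RGet 2 (getv 9))) (RSub (RGet 0 (getv 11)) (RGet 2 (getv 11))).
Definition slackY :=
  RSub (RAdd (RGet 1 (getv 11)) (RGet 2 (getv 11))) (RAdd (RGet 1 (getv 9)) (RGet 2 (getv 9))).
Definition relax_node := If (inside 15 (getv 9)) Skip
  (Seq (relax_arc arcX slackX 1) (relax_arc arcY slackY 0)).
Definition relax := For 9 1 relax_node.

Definition candidate := BAnd (BNot (inside 15 (getv 9))) (inside 16 (getv 9)).
Definition raise_node := If (inside 15 (getv 9)) Skip
  (Seq (RSet 2 (getv 9) (RAdd (RGet 2 (getv 9)) (RGet 4 (INum 0))))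
       (RSet 3 (getv 9) (RSub (RGet 3 (getv 9)) (RGet 4 (INum 0))))).
Definition sink := BAnd (inside 4 best) (BNot (inside 3 best)).
(** The least key is saved in the scratch cell because the raising loop also lowers the key of the
    chosen node, which is inserted only afterwards. *)
Definition search_step :=
  Seq (argmin candidate 3)
 (Seq (RSet 4 (INum 0) (RGet 3 best))
 (Seq (For 9 1 raise_node)
 (Seq (ISet 15 best (INum 1))
      (If sink (setv 18 (getv 8)) (Seq (setv 11 best) relax))))).

Section Search.

Variables (R : realFieldType) (G : graph) (C c : 'I_(ne G) -> R).
Local Notation E := 'I_(ne G).
Implicit Types (s : state R) (X Y : {set E}) (q : seq E) (th : R).

Definition alpha s (e : E) : R := rmem s 2 e.
Definition key s (e : E) : R := rmem s 3 e.
Definition par s (e : E) : nat := imem s 16 e.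
Definition typ s (e : E) : bool := imem s 17 e != 0%N.

Definition static s X Y : Prop :=
  [/\ has_graph G s, holds_set s 3 X /\ holds_set s 4 Y, holds_base G s,
      holds_exchanges s 13 X /\ holds_exchanges s 14 Y &
      (forall e : E, rmem s 0 e = C e) /\ (forall e : E, rmem s 1 e = c e)].

Lemma static_agree li lr s s' X Y :
  all (fun a => a \notin li) [:: 0; 1; 2; 3; 4; 12; 13; 14]%N ->
  all (fun a => a \notin lr) [:: 0; 1]%N ->
  agree li lr s s' -> static s X Y -> static s' X Y.
Proof.
move=> /allP li0 /allP lr0 ag [hg [sX sY] sb [eX eY] [sC sc]]; have [h1 h2] := ag.
split.
- by apply: has_graph_agree ag hg; apply: li0.
- by split; [apply: holds_set_agree ag sX | apply: holds_set_agree ag sY]; apply: li0.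
- by move=> u; rewrite h1 //; apply: li0.
- by split=> u v; rewrite h1 //; apply: li0.
- by split=> e; rewrite h2 //; apply: lr0.
Qed.

Lemma relax_arc_run s cond len t v u : imem s 9 0 = v -> imem s 11 0 = u ->
  let better := beval s cond && ((imem s 16 v == 0%N) || (reval s len < rmem s 3 v)) in
  let s' := run (relax_arc cond len t) s in
  [/\ agree [:: 16; 17]%N [:: 3; 4]%N s s',
      forall i, imem s' 16 i = if better && (i == v) then u.+1 else imem s 16 i,
      forall i, imem s' 17 i = if better && (i == v) then t else imem s 17 i &
      forall i, rmem s' 3 i = if better && (i == v) then reval s len else rmem s 3 i].
Proof.
move=> xv xu better; rewrite /relax_arc run_if /better.
case: (beval s cond) => //=; rewrite xv lt0n -/(reval s len).
have -> : upd (rmem s) 4 0 (reval s len) 4 0 = reval s len by [].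
rewrite leNgt -negb_or; case: (_ || _) => /=; last first.
  by split=> // *; apply: agree_setr.
have -> : upd (imem s) 16 v (imem s 11 0 + 1)%N 9 0 = v by rewrite -xv.
rewrite xu addn1; split=> //.
by do 2!apply: agree_seti => //; do 2!apply: agree_setr => //.
Qed.

Lemma arcX_val s X Y (u v : E) : static s X Y -> imem s 9 0 = v -> imem s 11 0 = u ->
  beval s arcX = exch_arc X Y true u v.
Proof. by move=> [_ _ sb [eX _] _] xv xu; rewrite /= xv xu sb eX lt0b. Qed.

Lemma arcY_val s X Y (u v : E) : static s X Y -> imem s 9 0 = v -> imem s 11 0 = u ->
  beval s arcY = exch_arc X Y false u v.
Proof.
by move=> [_ _ sb [_ eY] _] xv xu; rewrite /= xv xu sb eY lt0b /exchanges andbCA.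
Qed.

Lemma slackX_val s X Y (u v : E) : static s X Y -> imem s 9 0 = v -> imem s 11 0 = u ->
  reval s slackX = slack C c (alpha s) true u v.
Proof. by move=> [_ _ _ _ [sC _]] xv xu; rewrite /= xv xu !sC. Qed.

Lemma slackY_val s X Y (u v : E) : static s X Y -> imem s 9 0 = v -> imem s 11 0 = u ->
  reval s slackY = slack C c (alpha s) false u v.
Proof. by move=> [_ _ _ _ [_ sc]] xv xu; rewrite /= xv xu !sc. Qed.

(** Node by node, the set of scanned arcs grows from [D0] to [D2] through two uses of
    [entering_relax], one per arc type. *)
Lemma relax_runs s X Y th q (u : E) M Q T :
  static s X Y -> (ne G <= M)%N -> (0 < M)%N ->
  certificate C c X Y (alpha s) th -> u \notin q -> imem s 11 0 = u ->
  holds_set s 15 [set e in rcons q u] ->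
  search C c X Y (rcons q u) (fun w _ => w \in q) (alpha s) (par s) (typ s) (key s) ->
  (forall s', agree [:: 9; 16; 17]%N [:: 3; 4]%N s s' ->
     search C c X Y (rcons q u) (fun w _ => w \in rcons q u)
       (alpha s') (par s') (typ s') (key s') -> Q s') ->
  (M * (ctime relax_node + 23) <= T)%N ->
  runs relax s T Q.
Proof.
move=> st mM M0 cert uq xu sS [uniq_q src ent entd] post le_T.
set q' := rcons q u in sS ent entd post *.
set D0 := fun (w : E) (_ : bool) => w \in q in ent.
set D2 := fun (w : E) (_ : bool) => w \in q'.
have le_u (w : E) : w \in q' -> (index w q' <= index u q')%N.
  rewrite /q' -index_mem size_rcons ltnS => h; apply: leq_trans h _.
  by rewrite -cats1 index_cat (negPf uq) /= eqxx addn0.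
have D0q w (t : bool) : D0 w t -> w \in q' by rewrite /D0 /q' mem_rcons inE => ->; rewrite orbT.
apply: (runs_for (N := ne G) (M := M) (tb := ctime relax_node) (I := fun i s' =>
  agree [:: 9; 16; 17]%N [:: 3; 4]%N s s' /\ forall v : E,
  (v \in X :\: Y \/ v \in q' -> [/\ par s' v = par s v, typ s' v = typ s v & key s' v = key s v]) /\
  (v \notin X :\: Y -> v \notin q' ->
     entering C c X Y q' (if (v < i)%N then D2 else D0) (alpha s) (par s' v) (typ s' v) (key s' v) v))) => //.
- split=> // v; split=> // vX vq; exact: ent.
- by move=> i s' v [ag h]; split; first exact: agree_seti.
- by move=> i s' [ag _]; rewrite (proj1 ag) //; case: st => -[].
- move=> i s1 lt x9 [ag h]; apply: runs_straight => //.
  have [v vi] : {v : E | val v = i} by exists (Ordinal lt).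
  have x11 : imem s1 11 0 = u by rewrite (proj1 ag).
  have x9v : imem s1 9 0 = v by rewrite vi.
  have st1 : static s1 X Y by apply: static_agree ag st.
  have al1 : alpha s1 = alpha s.
    by apply: functional_extensionality => e; rewrite /alpha (proj2 ag).
  have ltS (w : E) : (w < i.+1)%N = (w == v) || (w < i)%N.
    by rewrite ltnS leq_eqVlt -val_eqE vi.
  rewrite /relax_node run_if.
  have -> : beval s1 (inside 15 (getv 9)) = (v \in q').
    by rewrite /= x9v (proj1 ag) // sS inE lt0b.
  case: ifPn => vq.
    split=> //; split=> // w; have [h1 h2] := h w; split=> // wX wq.
    rewrite ltS (_ : w == v = false) //; first exact: h2.
    by apply: contraNF wq => /eqP->.
  rewrite run_seq.
  have := relax_arc_run arcX slackX 1 x9v x11; cbv zeta.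
  set s2 := run (relax_arc arcX slackX 1) s1.
  rewrite (arcX_val st1 x9v x11) (slackX_val st1 x9v x11) al1 => -[ag2 p2 t2 k2].
  have x92 : imem s2 9 0 = v by rewrite (proj1 ag2).
  have x112 : imem s2 11 0 = u by rewrite (proj1 ag2).
  have st2 : static s2 X Y by apply: static_agree ag2 st1.
  have al2 : alpha s2 = alpha s.
    by rewrite -al1; apply: functional_extensionality => e; rewrite /alpha (proj2 ag2).
  have := relax_arc_run arcY slackY 0 x92 x112; cbv zeta.
  set s3 := run (relax_arc arcY slackY 0) s2.
  rewrite (arcY_val st2 x92 x112) (slackY_val st2 x92 x112) al2 => -[ag3 p3 t3 k3].
  have ag' : agree [:: 9; 16; 17]%N [:: 3; 4]%N s s3.
    apply: agree_trans ag (agree_trans (agree_sub _ _ ag2) (agree_sub _ _ ag3)) => //;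
      by apply/allP.
  split; first by rewrite (proj1 ag3) // (proj1 ag2).
  split=> // w; have [h1 h2] := h w.
  case: (eqVneq w v) => [->|wv]; last first.
    have wv' : (w == v :> nat) = false by rewrite val_eqE (negPf wv).
    rewrite /par /typ /key p3 t3 k3 wv' !andbF p2 t2 k2 wv' !andbF ltS (negPf wv) /=.
    by split.
  case: (h v) => {}h1 {}h2.
  rewrite /par /typ /key p3 t3 k3 p2 t2 k2 !eqxx !andbT.
  split=> [[vX|]|vX _]; last 2 first.
  - by rewrite (negPf vq).
  - have := h2 vX vq; rewrite ltS eqxx orTb (_ : (v < i)%N = false) => [e0|]; last by rewrite -vi ltnn.
    have e1 := entering_relax (u := u) true (fun w t h => le_u w (D0q w t h)) e0.
    cbv zeta in e1.
    have le1 w' (t : bool) : D0 w' t || (w' == u) && (t == true) -> (index w' q' <= index u q')%N.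
      by move=> /orP[/D0q/le_u//|/andP[/eqP-> _]].
    have e2 := entering_relax (u := u) false le1 e1.
    cbv zeta in e2.
    have De (w' : E) (t : bool) :
        (D0 w' t || (w' == u) && (t == true)) || (w' == u) && (t == false) = D2 w' t.
      rewrite /D0 /D2 /q' mem_rcons inE orbC.
      by case: t; case: (_ == u); case: (_ \in q).
    apply: (entering_eq De); move: e2; rewrite /par /typ /key.
    set b1 := exch_arc X Y true u v && _; set b2 := exch_arc X Y false u v && _.
    by case: b2; case: b1.
  (* No slack undercuts the key 0 of a source, so the program can relax sources like all other
     nodes. *)
  have [pe ke] := src v vX; have {}ke := ke vq.
  have [pv tv kv] := h1 (or_introl vX).
  move: pv tv kv; rewrite /par /typ /key in pe ke * => pv tv kv.
  have nX : exch_arc X Y true u v && ((imem s1 16 v == 0%N) || (slack C c (alpha s) true u v < rmem s1 3 v)) = false.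
    apply/negbTE/negP => /andP[a /orP[]]; first by rewrite pv pe.
    by rewrite kv ke ltNge (slack_ge0 cert a).
  rewrite nX; have -> : exch_arc X Y false u v && ((imem s1 16 v == 0%N) || (slack C c (alpha s) false u v < rmem s1 3 v)) = false.
    apply/negbTE/negP => /andP[a /orP[]]; first by rewrite pv pe.
    by rewrite kv ke ltNge (slack_ge0 cert a).
  by [].
move=> s' [ag h]; apply: post => //.
have -> : alpha s' = alpha s.
  by apply: functional_extensionality => e; rewrite /alpha (proj2 ag).
split=> //.
- move=> e eX; have [h1 _] := h e; have [-> _ ->] := h1 (or_introl eX); exact: src.
- move=> v vX vq; have [_ h2] := h v; have := h2 vX vq; by rewrite ltn_ord.
- move=> v vX vq; have [h1 _] := h v; have [-> -> _] := h1 (or_intror vq); exact: entd.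
Qed.

End Search.

Definition stepK := (argminK candidate 3 + ctime raise_node + ctime relax_node + 200)%N.

Section SearchLoop.

Variables (R : realFieldType) (G : graph) (C c : 'I_(ne G) -> R).
Local Notation E := 'I_(ne G).
Implicit Types (s : state R) (X Y : {set E}) (q : seq E) (th : R).

Lemma raise_runs s q (d : R) M Q T :
  has_graph G s -> (ne G <= M)%N -> (0 < M)%N ->
  rmem s 4 0 = d -> holds_set s 15 [set e in q] ->
  (forall s', agree [:: 9]%N [:: 2; 3]%N s s' ->
     @alpha _ G s' = raise q (alpha s) d -> @key _ G s' = lower q (key s) d -> Q s') ->
  (M * (ctime raise_node + 23) <= T)%N ->
  runs (For 9 1 raise_node) s T Q.
Proof.
move=> hg mM M0 sd sS post le_T.
apply: (runs_for (N := ne G) (M := M) (tb := ctime raise_node) (I := fun i s' =>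
  agree [:: 9]%N [:: 2; 3]%N s s' /\ forall e : E,
    alpha s' e = (if (e < i)%N then raise q (alpha s) d e else alpha s e) /\
    key s' e = (if (e < i)%N then lower q (key s) d e else key s e))) => //.
- by move=> i s' v [ag h]; split; first exact: agree_seti.
- by move=> i s' [ag _]; rewrite (proj1 ag) //; case: hg.
- move=> i s1 lt x9 [ag h]; apply: runs_straight => //.
  have [v vi] : {v : E | val v = i} by exists (Ordinal lt).
  have x9v : imem s1 9 0 = v by rewrite vi.
  have ltS (w : E) : (w < i.+1)%N = (w == v) || (w < i)%N.
    by rewrite ltnS leq_eqVlt -val_eqE vi.
  have vv : (v < i)%N = false by rewrite -vi ltnn.
  rewrite /raise_node run_if.
  have -> : beval s1 (inside 15 (getv 9)) = (v \in q).
    by rewrite /= x9v (proj1 ag) // sS inE lt0b.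
  have [av kv] := h v; rewrite vv in av kv.
  case: ifPn => vq.
    split=> //; split=> // w; have [h1 h2] := h w; rewrite ltS h1 h2.
    by case: (eqVneq w v) => [->|//]; rewrite vv /= /raise /lower vq.
  have -> : run (Seq (RSet 2 (getv 9) (RAdd (RGet 2 (getv 9)) (RGet 4 (INum 0))))
       (RSet 3 (getv 9) (RSub (RGet 3 (getv 9)) (RGet 4 (INum 0))))) s1 =
    State (imem s1) (upd (upd (rmem s1) 2 v (rmem s1 2 v + rmem s1 4 0))
      3 v (rmem s1 3 v - rmem s1 4 0)).
    by rewrite /= x9v.
  split=> //; split; first by do 2!apply: agree_setr => //.
  move=> w; rewrite /alpha /key /= !updE /= ltS -val_eqE /=; have [h1 h2] := h w.
  case: (eqVneq (val w) (val v)) => [/val_inj->|wv] //=.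
  rewrite /raise /lower (negPf vq); rewrite /alpha /key in av kv.
  by rewrite -av -kv ((proj2 ag) 4%N) // sd.
- move=> s' [ag h]; apply: post => //; apply: functional_extensionality => e.
    by have [-> _] := h e; rewrite ltn_ord.
  by have [_ ->] := h e; rewrite ltn_ord.
Qed.

(** A sink is not relaxed once inserted, so in that case the invariant is passed on with an
    unspecified [D]. *)
Lemma search_step_runs s X Y th q M Q T :
  static C c s X Y -> (ne G <= M)%N -> (0 < M)%N ->
  certificate C c X Y (alpha s) th ->
  search C c X Y q (fun w _ => w \in q) (alpha s) (par s) (typ s) (key s) ->
  holds_set s 15 [set e in q] ->
  (forall e, e \in q -> e \notin Y :\: X) -> (0 < #|Y :\: X|)%N ->
  (forall s' b th' D, agree [:: 8; 9; 11; 15; 16; 17; 18]%N [:: 2; 3; 4]%N s s' ->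
     b \notin q -> certificate C c X Y (alpha s') th' ->
     search C c X Y (rcons q b) D (alpha s') (par s') (typ s') (key s') ->
     holds_set s' 15 [set e in rcons q b] ->
     (b \in Y :\: X /\ imem s' 18 0 = b.+1) \/
     [/\ b \notin Y :\: X, imem s' 18 0 = imem s 18 0 &
         D = fun w _ => w \in rcons q b] -> Q s') ->
  (M * stepK <= T)%N ->
  runs search_step s T Q.
Proof.
move=> st mM M0 cert sea sS qY YX0 post le_T.
have : runs search_step s (M * argminK candidate 3 + (7 + (M * (ctime raise_node + 23) +
   (6 + (btime sink + (6 + M * (ctime relax_node + 23))).+1))))%N Q; last first.
  move=> h; apply: runs_weaken h _ (fun _ h => h); apply: leq_trans le_T.
  rewrite /stepK (_ : btime sink = 16%N) //.
  by move: (argminK _ _) (ctime _) (ctime _) => a b d; nia.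
have hg : has_graph G s by case: st.
apply: runs_seq; apply: (argmin_runs (m := ne G) (M := M)
  (P := fun e => (e \notin q) && (par s e != 0%N))) => //.
- by case: hg.
- move=> s' e ag x9; rewrite /= x9 (proj1 ag) // (proj1 ag) // sS inE !lt0n.
  by case: (e \in q).
move=> s1 ag1 [[_ none]|[b [xb /andP[bq pb] minb]]].
  have [v vP] := search_candidate cert sea qY YX0.
  by have := none v; rewrite vP.
have cand := search_pick cert sea qY bq pb; cbv zeta in cand.
have {cand} [cert' sea'] := cand (fun v vq pv => minb v (introT andP (conj vq pv))).
apply: runs_seq; apply: runs_straight => //; set s2 := run _ s1.
have ag2 : agree [:: 8; 9]%N [:: 4]%N s s2.
  by apply: agree_setr => //; apply: agree_sub ag1.
have d2 : rmem s2 4 0 = key s b.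
  by rewrite /s2 /= updE /= xb subn1 /= (proj2 ag1).
have al2 : @alpha _ G s2 = alpha s.
  by apply: functional_extensionality => e; rewrite /alpha (proj2 ag2).
have k2 : @key _ G s2 = key s.
  by apply: functional_extensionality => e; rewrite /key (proj2 ag2).
have hg2 : has_graph G s2 by apply: has_graph_agree ag2 hg.
have sS2 : holds_set s2 15 [set e in q] by apply: holds_set_agree ag2 sS.
apply: runs_seq; apply: (raise_runs (M := M) hg2 mM M0 d2 sS2) => // s3 ag3.
rewrite al2 k2 => al3 k3.
have xb3 : imem s3 8 0 = b.+1 by rewrite (proj1 ag3) // -xb.
have ags3 : agree [:: 8; 9; 11; 15; 16; 17; 18]%N [:: 2; 3; 4]%N s s3.
  by apply: agree_trans (agree_sub _ _ ag2) (agree_sub _ _ ag3) => //; apply/allP.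
have p3 : @par _ G s3 = par s.
  by apply: functional_extensionality => e; rewrite /par (proj1 ag3) // (proj1 ag2).
have t3 : @typ _ G s3 = typ s.
  by apply: functional_extensionality => e; rewrite /typ (proj1 ag3) // (proj1 ag2).
rewrite -al3 in cert'; rewrite -al3 -k3 -p3 -t3 in sea'.
apply: runs_seq; apply: runs_straight => //; set s4 := run _ s3.
have ags4 : agree [:: 8; 9; 11; 15; 16; 17; 18]%N [:: 2; 3; 4]%N s s4.
  exact: agree_seti.
have s4E : s4 = State (upd (imem s3) 15 b 1%N) (rmem s3).
  by rewrite /s4 /= xb3 subn1.
clearbody s4.
have xb4 : imem s4 8 0 = b.+1 by rewrite s4E.
have sS4 : holds_set s4 15 [set e in rcons q b].
  rewrite s4E (_ : [set e in rcons q b] = b |: [set e in q]); last first.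
    by apply/setP => e; rewrite !inE mem_rcons inE.
  by apply: holds_set_add => //; apply: holds_set_agree ag3 sS2.
have st4 : static C c s4 X Y by apply: static_agree ags4 st.
apply: runs_if.
have -> : beval s4 sink = (b \in Y :\: X).
  case: st4 => _ [sX sY] _ _ _.
  by rewrite /= xb4 subn1 /= sX sY !lt0b inE andbC.
case: ifPn => bY.
  apply: runs_straight => //; set s5 := run _ s4.
  have s5E : s5 = State (upd (imem s4) 18 0 b.+1) (rmem s4).
    by rewrite /s5 /= xb4.
  clearbody s5.
  apply: (post s5 b _ _ _ bq _ _ _ (or_introl _)); last 1 first.
  - by split=> //; rewrite s5E.
  - by rewrite s5E; apply: agree_seti.
  - by rewrite s5E s4E; apply: cert'.
  - by rewrite s5E s4E; apply: sea'.
  - by rewrite s5E; exact: sS4.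
apply: runs_seq; apply: runs_straight => //; set s5 := run _ s4.
have s5E : s5 = State (upd (imem s4) 11 0 b) (rmem s4).
  by rewrite /s5 /= xb4 subn1.
clearbody s5.
have ags5 : agree [:: 8; 9; 11; 15; 16; 17; 18]%N [:: 2; 3; 4]%N s s5.
  by rewrite s5E; apply: agree_seti.
have st5 : static C c s5 X Y by apply: static_agree ags5 st.
have sS5 : holds_set s5 15 [set e in rcons q b] by rewrite s5E; exact: sS4.
have cert5 : certificate C c X Y (alpha s5) (th + key s b) by rewrite s5E s4E.
have x11 : imem s5 11 0 = b by rewrite s5E.
apply: (relax_runs st5 mM M0 cert5 bq x11 sS5) => //.
  by rewrite s5E s4E; apply: sea'.
move=> s6 ag6 sea6.
have al6 : @alpha _ G s6 = alpha s5.
  by apply: functional_extensionality => e; rewrite /alpha (proj2 ag6).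
apply: (post s6 b _ _ _ bq _ sea6 _ (or_intror _)).
- by apply: agree_trans ags5 (agree_sub _ _ ag6) => //; apply/allP.
- by rewrite al6; apply: cert5.
- by apply: holds_set_agree ag6 sS5.
- by split=> //; rewrite (proj1 ag6) // s5E s4E /= !updE /= (proj1 ag3) // (proj1 ag2).
Qed.

Definition search_loop := While (BIle (getv 18) (INum 0)) search_step.

(** Every round adds a node to the duplicate-free [q], so there are at most [ne G] rounds. The first
    sink inserted ends the loop, so no node before it is a sink. *)
Lemma search_loop_runs s X Y th M Q T :
  static C c s X Y -> (ne G <= M)%N -> (0 < M)%N ->
  certificate C c X Y (alpha s) th ->
  search C c X Y [::] (fun w _ => w \in [::]) (alpha s) (par s) (typ s) (key s) ->
  holds_set s 15 (@set0 E) -> imem s 18 0 = 0%N -> (0 < #|Y :\: X|)%N ->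
  (forall s' b q th' D, agree [:: 8; 9; 11; 15; 16; 17; 18]%N [:: 2; 3; 4]%N s s' ->
     b \in Y :\: X -> imem s' 18 0 = b.+1 -> certificate C c X Y (alpha s') th' ->
     search C c X Y q D (alpha s') (par s') (typ s') (key s') -> b \in q ->
     (forall e, (index e q < index b q)%N -> e \notin Y :\: X) -> Q s') ->
  (M * (M * (stepK + 20)) <= T)%N ->
  runs search_loop s T Q.
Proof.
move=> st mM M0 cert0 sea0 sS0 x18 YX0 post le_T; rewrite /search_loop.
pose I j s' := exists q th' D,
  [/\ agree [:: 8; 9; 11; 15; 16; 17; 18]%N [:: 2; 3; 4]%N s s',
      certificate C c X Y (alpha s') th',
      search C c X Y q D (alpha s') (par s') (typ s') (key s'),
      holds_set s' 15 [set e in q] /\ (j + size q = ne G)%N &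
      [/\ imem s' 18 0 = 0%N, D = (fun w _ => w \in q) & forall e, e \in q -> e \notin Y :\: X]
      \/ exists b : E, [/\ imem s' 18 0 = b.+1, b \in Y :\: X, b \in q &
         forall e, (index e q < index b q)%N -> e \notin Y :\: X]].
apply: (@runs_while _ _ _ s I (ne G) (M * stepK)%N).
- exists [::], th, (fun w _ => w \in [::]); split=> //.
    by split; [move=> e; rewrite sS0 !inE | rewrite addn0].
  by left.
- move=> j s1 [q [th1 [D [ag cert sea [sS jq] [[x0 DE qY]|[b [xb _ _ _]]]]]]]; last by rewrite /= xb.
  rewrite DE in sea => _.
  have st1 : static C c s1 X Y by apply: static_agree ag st.
  have szq (q' : seq E) : uniq q' -> (size q' <= ne G)%N.
    by move=> /card_uniqP <-; have := max_card (mem q'); rewrite card_ord.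
  split.
    have [uq _ _ _] := sea; have [v /andP[vq _]] := search_candidate cert sea qY YX0.
    have : uniq (rcons q v) by rewrite rcons_uniq vq.
    by move/szq; rewrite size_rcons; lia.
  apply: (search_step_runs st1 mM M0 cert sea sS qY YX0) => // s2 b th2 D2 ag2 bq cert2 sea2 sS2 h.
  have := sea2 => -[/szq]; rewrite size_rcons => szb _ _ _.
  exists j.-1; first by lia.
  exists (rcons q b), th2, D2; split=> //.
  - exact: agree_trans ag ag2.
  - by split=> //; rewrite size_rcons; lia.
  have bE (e : E) : e \in rcons q b -> e != b -> e \in q.
    by rewrite mem_rcons inE => /orP[/eqP->|//]; rewrite eqxx.
  case: h => [[bY x2]|[bY x2 DE2]]; [right|left].
    exists b; split=> //; first by rewrite mem_rcons mem_head.
    move=> e; rewrite -!cats1 !index_cat (negPf bq) /= eqxx addn0.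
    by case: ifP => [/qY//|_]; rewrite ltnNge leq_addr.
  split=> //; first by rewrite x2.
  move=> e; rewrite mem_rcons inE => /orP[/eqP->//|]; exact: qY.
- move=> j s1 [q [th1 [D [ag cert sea _ [[x0 _ _]|[b [xb bY bq lt]]]]]]]; first by rewrite /= x0.
  by move=> _; apply: (post s1 b q th1 D).
apply: leq_trans le_T; move: stepK => a /=; nia.
Qed.

End SearchLoop.

(** * Augmentation and the whole program *)

Definition flip := If (inside 17 (getv 9))
  (Seq (ISet 3 (getv 11) (INum 0)) (ISet 3 (getv 9) (INum 1)))
  (Seq (ISet 4 (getv 9) (INum 0)) (ISet 4 (getv 11) (INum 1))).
Definition locate :=
  Seq (setv 11 (pred1e (IGet 16 (pred1e (getv 20))))) (setv 9 (pred1e (getv 20))).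
Definition back_step := Seq locate (Seq flip (setv 20 (succe (getv 11)))).
Definition back_guard := BNot (bSame (IGet 16 (pred1e (getv 20))) (getv 20)).
Definition backtrace := While back_guard back_step.
Definition backK := (btime back_guard + btime back_guard + ctime back_step + 20)%N.

(** The language has no real constants, so the key 0 of a source is computed as x - x. Other nodes
    keep stale keys, which are not consulted while the parent is 0. *)
Definition init_node := Seq (ISet 15 (getv 9) (INum 0))
  (If (BAnd (inside 3 (getv 9)) (BNot (inside 4 (getv 9))))
    (Seq (ISet 16 (getv 9) (succe (getv 9)))
         (RSet 3 (getv 9) (RSub (RGet 3 (getv 9)) (RGet 3 (getv 9)))))
    (ISet 16 (getv 9) (INum 0))).

Definition phase :=
  Seq (exch 3 13) (Seq (exch 4 14) (Seq (For 9 1 init_node)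
  (Seq (setv 18 (INum 0)) (Seq search_loop (Seq (setv 20 (getv 18)) backtrace))))).
Definition phaseK := (exchK + exchK + ctime init_node + stepK + backK + 100)%N.

Section Phase.

Variables (R : realFieldType) (G : graph) (C c : 'I_(ne G) -> R).
Local Notation E := 'I_(ne G).
Implicit Types (s : state R) (X Y : {set E}) (q r : seq E) (th : R).

(** Parents and arc types are only read, hence remain those of the initial state [s], while the
    trees change with every swap. The walk ends at the node that is its own parent. *)
Lemma backtrace_runs s X Y th n (v : E) r M Q T :
  (ne G <= M)%N -> (0 < M)%N -> (size r <= ne G)%N ->
  imem s 20 0 = v.+1 -> holds_set s 3 X -> holds_set s 4 Y ->
  trail (par s) v r -> augmenting C c X Y (alpha s) th (typ s) n v r ->
  (forall s' X' Y', agree [:: 3; 4; 9; 11; 20]%N [::] s s' ->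
     holds_set s' 3 X' -> holds_set s' 4 Y' -> certificate C c X' Y' (alpha s') th ->
     #|Y' :\: X'| = n -> Q s') ->
  (M * backK <= T)%N ->
  runs backtrace s T Q.
Proof.
move=> mM M0 szr xv sX sY tr aug post le_T; rewrite /backtrace.
pose I j s' := exists (v : E) r X Y,
  [/\ agree [:: 3; 4; 9; 11; 20]%N [::] s s', (size r <= j)%N /\ imem s' 20 0 = v.+1,
      trail (par s) v r, holds_set s' 3 X /\ holds_set s' 4 Y &
      augmenting C c X Y (alpha s) th (typ s) n v r].
have guardE (w : E) r' X' Y' s' : agree [:: 3; 4; 9; 11; 20]%N [::] s s' ->
    imem s' 20 0 = w.+1 -> trail (par s) w r' ->
    augmenting C c X' Y' (alpha s) th (typ s) n w r' ->
    beval s' back_guard = (r' != [::]).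
  move=> ag xw; rewrite /= xw subn1 /= (proj1 ag) // -eqn_leq.
  case: r' => [|u r'] /=; first by rewrite -[imem s 16 w]/(par s w) => -> _; rewrite eqxx.
  rewrite -[imem s 16 w]/(par s w) => -[-> _] [_ _ _ /andP[uw _] _].
  by apply: contra uw; rewrite eqSS => /eqP/val_inj->; rewrite mem_head.
apply: (@runs_while _ _ _ s I (size r) (ctime back_step)).
- by exists v, r, X, Y.
- move=> j s1 [w [r1 [X1 [Y1 [ag [sz x20] tr1 [sX1 sY1] aug1]]]]].
  rewrite (guardE w r1 X1 Y1) //; case: r1 sz tr1 aug1 => // u r1 sz [pw tr1] aug1 _.
  split; first exact: leq_trans sz.
  apply: runs_straight => //.
  rewrite /back_step run_seq; set s2 := run locate s1.
  have s2E : s2 = State (upd (upd (imem s1) 11 0 u) 9 0 w) (rmem s1).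
    rewrite /s2 /= x20 !updE /= x20 (_ : w.+1 - 1 = w)%N ?subn1 // (proj1 ag) //.
    by rewrite -[imem s 16 w]/(par s w) pw.
  clearbody s2; rewrite run_seq; set s3 := run flip s2.
  have x2 : (imem s2 9 0 = w) * (imem s2 11 0 = u) by rewrite s2E.
  have sX2 : holds_set s2 3 X1 by rewrite s2E.
  have sY2 : holds_set s2 4 Y1 by rewrite s2E.
  have ag2 : agree [:: 3; 4; 9; 11; 20]%N [::] s s2.
    by rewrite s2E; do 2!apply: agree_seti => //.
  have tE : beval s2 (inside 17 (getv 9)) = typ s w.
    by rewrite /= x2 (proj1 ag2) // lt0n.
  have s3E : s3 = State (imem s3) (rmem s2) by rewrite /s3 /flip run_if; case: ifP.
  have {s3E} [ag3 sX3 sY3] : [/\ agree [:: 3; 4; 9; 11; 20]%N [::] s s3,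
      holds_set s3 3 (augX (typ s w) u w X1) & holds_set s3 4 (augY (typ s w) u w Y1)].
    rewrite /s3 /flip run_if tE; case: (typ s w) => /=.
      rewrite !updE /= !x2; split=> //; first by do 2!apply: agree_seti => //.
      by apply: holds_set_add => //; apply: holds_set_del.
    rewrite !updE /= !x2; split=> //; first by do 2!apply: agree_seti => //.
    by apply: holds_set_add => //; apply: holds_set_del.
  have x3 : imem s3 11 0 = u.
    by rewrite /s3 /flip run_if; case: ifP => _; rewrite /= !updE /= x2.
  clearbody s3; rewrite /= x3 addn1.
  exists (size r1) => //; exists u, r1, (augX (typ s w) u w X1), (augY (typ s w) u w Y1).
  split=> //; first exact: agree_seti.
  exact: augmenting_step.
- move=> j s1 [w [r1 [X1 [Y1 [ag [_ x20] tr1 [sX1 sY1] aug1]]]]].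
  rewrite (guardE w r1 X1 Y1) // negbK => /eqP r0; rewrite r0 in aug1.
  case: aug1 => cert card; apply: (post s1 X1 Y1) => //.
  suff -> : @alpha _ G s1 = alpha s by [].
  by apply: functional_extensionality => e; rewrite /alpha (proj2 ag).
apply: leq_trans le_T; rewrite /backK; move: (btime _) (ctime _) => a b.
have := leq_mul (leq_trans szr mM) (leqnn (a + b).+1); nia.
Qed.

(** What persists between phases; the exchange matrices, present in [static], depend on the trees
    and are recomputed. *)
Definition problem s X Y : Prop :=
  [/\ has_graph G s, holds_set s 3 X /\ holds_set s 4 Y, holds_base G s &
      (forall e : E, rmem s 0 e = C e) /\ (forall e : E, rmem s 1 e = c e)].

Lemma init_runs s X Y M Q T :
  problem s X Y -> (ne G <= M)%N -> (0 < M)%N ->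
  (forall s', agree [:: 9; 15; 16]%N [:: 3]%N s s' ->
     holds_set s' 15 (@set0 E) ->
     (forall e : E, par s' e = if e \in X :\: Y then e.+1 else 0%N) ->
     (forall e : E, e \in X :\: Y -> key s' e = 0) -> Q s') ->
  (M * (ctime init_node + 23) <= T)%N ->
  runs (For 9 1 init_node) s T Q.
Proof.
move=> [hg [sX sY] _ _] mM M0 post le_T.
apply: (runs_for (N := ne G) (M := M) (tb := ctime init_node) (I := fun i s' =>
  agree [:: 9; 15; 16]%N [:: 3]%N s s' /\ forall e : E, (e < i)%N ->
    [/\ imem s' 15 e = 0%N, par s' e = (if e \in X :\: Y then e.+1 else 0%N) &
        e \in X :\: Y -> key s' e = 0])) => //.
- by move=> i s' v [ag h]; split; first exact: agree_seti.
- by move=> i s' [ag _]; rewrite (proj1 ag) //; case: hg.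
- move=> i s1 lt x9 [ag h]; apply: runs_straight => //.
  have [v vi] : {v : E | val v = i} by exists (Ordinal lt).
  have x9v : imem s1 9 0 = v by rewrite vi.
  have ltS (w : E) : (w < i.+1)%N = (w == v) || (w < i)%N.
    by rewrite ltnS leq_eqVlt -val_eqE vi.
  rewrite /par /key in h.
  rewrite /init_node run_seq; set s2 := run _ s1.
  have s2E : s2 = State (upd (imem s1) 15 v 0%N) (rmem s1) by rewrite /s2 /= x9v.
  clearbody s2.
  have ag2 : agree [:: 9; 15; 16]%N [:: 3]%N s s2 by rewrite s2E; apply: agree_seti.
  have x2 : imem s2 9 0 = v by rewrite s2E.
  rewrite run_if.
  have -> : beval s2 (BAnd (inside 3 (getv 9)) (BNot (inside 4 (getv 9)))) = (v \in X :\: Y).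
    by rewrite /= x2 !(proj1 ag2) // sX sY !lt0b inE andbC.
  case: ifPn => vX.
    have -> : run (Seq (ISet 16 (getv 9) (succe (getv 9)))
        (RSet 3 (getv 9) (RSub (RGet 3 (getv 9)) (RGet 3 (getv 9))))) s2 =
        State (upd (imem s2) 16 v v.+1) (upd (rmem s2) 3 v (rmem s2 3 v - rmem s2 3 v)).
      by rewrite /= !updE /= x2 addn1.
    split; first by rewrite /= updE /= x2.
    split; first by apply: agree_seti => //; apply: agree_setr.
    move=> e; rewrite ltS /par /key /= !updE /= s2E /= !updE /= -val_eqE /=.
    case: (eqVneq (val e) (val v)) => [/val_inj->|ev] /=; first by rewrite vX subrr.
    by move=> /h[-> -> k0].
  have -> : run (ISet 16 (getv 9) (INum 0)) s2 = State (upd (imem s2) 16 v 0%N) (rmem s2).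
    by rewrite /= x2.
  split; first by rewrite /= updE /= x2.
  split; first by apply: agree_seti.
  move=> e; rewrite ltS /par /key /= !updE /= s2E /= !updE /= -val_eqE /=.
  case: (eqVneq (val e) (val v)) => [/val_inj->|ev] /=; first by rewrite (negPf vX).
  by move=> /h[-> -> k0].
move=> s' [ag h]; apply: post => // e; have [h1 h2 h3] := h e (ltn_ord e) => //.
by rewrite h1 inE.
Qed.

(** [al] is carried over from the preceding phase and only the search data are reset. The two
    matrices dominate the time: the search is quadratic and the walk linear in [M]. *)
Lemma phase_runs s X Y th n M Q T :
  problem s X Y -> (ne G <= M)%N -> (0 < M)%N -> (0 < nv G)%N ->
  certificate C c X Y (alpha s) th -> #|Y :\: X| = n.+1 ->
  (forall s' X' Y' th',
     agree [:: 3; 4; 5; 6; 7; 8; 9; 10; 11; 13; 14; 15; 16; 17; 18; 20; 21]%N [:: 2; 3; 4]%N s s' ->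
     holds_set s' 3 X' -> holds_set s' 4 Y' -> certificate C c X' Y' (alpha s') th' ->
     #|Y' :\: X'| = n -> Q s') ->
  (phaseK * (M * (nv G * M)) <= T)%N ->
  runs phase s T Q.
Proof.
set L := [:: 3; 4; 5; 6; 7; 8; 9; 10; 11; 13; 14; 15; 16; 17; 18; 20; 21]%N.
move=> pb mM M0 n0 cert card post le_T; have [hg [sX sY] sb sC] := pb.
have [mX mY _ _ _] := cert.
have : runs phase s (exchK * (M * (nv G * M)) + (exchK * (M * (nv G * M)) +
  (M * (ctime init_node + 23) + (3 + (M * (M * (stepK + 20)) + (4 + M * backK))))))%N Q; last first.
  move=> h; apply: runs_weaken h _ (fun _ h => h); apply: leq_trans le_T.
  have h1 : (M <= M * (nv G * M))%N by apply: leq_pmulr; rewrite muln_gt0 n0.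
  have h2 : (M * M <= M * (nv G * M))%N by rewrite leq_mul2l leq_pmull ?orbT.
  rewrite /phaseK; move: exchK (ctime init_node) stepK backK => a b d e.
  move: (M * (nv G * M))%N h1 h2 => P h1 h2.
  have h3 := leq_mul h1 (leqnn (b + e + 30)).
  have h4 := leq_mul h2 (leqnn (d + 20)); lia.
apply: runs_seq; apply: (exch_runs (G := G) (X := X) (M := M)) => //.
  exact: min_tree_tree mX.
move=> s1 ag1 ex1.
have hg1 : has_graph G s1 by apply: has_graph_agree ag1 hg.
have sY1 : holds_set s1 4 Y by apply: holds_set_agree ag1 sY.
have sb1 : holds_base G s1 by move=> u; rewrite (proj1 ag1).
apply: runs_seq; apply: (exch_runs (G := G) (X := Y) (M := M)) => //.
  exact: min_tree_tree mY.
move=> s2 ag2 ey2.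
have ags2 : agree L [::] s s2.
  by apply: agree_trans (agree_sub _ _ ag1) (agree_sub _ _ ag2) => //; apply/allP.
have ex2 : holds_exchanges s2 13 X by move=> u v; rewrite (proj1 ag2) // ex1.
have pb2 : problem s2 X Y.
  split.
  - exact: has_graph_agree ag2 hg1.
  - split; last by apply: holds_set_agree ag2 sY1.
    by apply: holds_set_agree ag2 _ => //; apply: holds_set_agree ag1 _.
  - by move=> u; rewrite (proj1 ag2).
  - by case: sC => h1 h2; split=> e; rewrite (proj2 ag2) // (proj2 ag1).
apply: runs_seq; apply: (init_runs (M := M) pb2) => // s3 ag3 sS3 p3 k3.
apply: runs_seq; apply: runs_straight => //; set s4 := run _ s3.
have s4E : s4 = State (upd (imem s3) 18 0 0%N) (rmem s3) by [].
clearbody s4.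
have ags4 : agree L [:: 2; 3; 4]%N s s4.
  rewrite s4E; apply: agree_seti => //.
  by apply: agree_trans (agree_sub _ _ ags2) (agree_sub _ _ ag3) => //; apply/allP.
have st4 : static C c s4 X Y.
  have st2 : static C c s2 X Y by case: pb2 => *; split.
  have st3 : static C c s3 X Y by apply: static_agree ag3 st2.
  by rewrite s4E; apply: static_agree st3; last exact: (agree_seti (li := [:: 18]%N) (lr := [::])).
have cert4 : certificate C c X Y (alpha s4) th.
  suff -> : @alpha _ G s4 = alpha s by [].
  apply: functional_extensionality => e; rewrite /alpha s4E /= (proj2 ag3) //.
  by rewrite (proj2 ag2) // (proj2 ag1).
apply: runs_seq; apply: (search_loop_runs (M := M) st4 mM M0 cert4) => //.
- split=> //.
  + by move=> e eX; rewrite s4E /par /key /= -[LHS]/(par s3 e) p3 eX; split=> // _; apply: k3.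
  + by move=> v vX _; left; rewrite s4E; split=> //; rewrite -[LHS]/(par s3 v) p3 (negPf vX).
- by move=> e; rewrite s4E; apply: sS3.
- by rewrite s4E.
- by rewrite card.
move=> s5 b q th5 D ag5 bY xb cert5 sea5 bq lt5.
apply: runs_seq; apply: runs_straight => //; set s6 := run _ s5.
have s6E : s6 = State (upd (imem s5) 20 0 b.+1) (rmem s5) by rewrite /s6 /= xb.
clearbody s6.
have [r [tr sh lX intr [ur ltr]]] := search_trail cert5 sea5 bq.
have [sX5 sY5] : holds_set s5 3 X /\ holds_set s5 4 Y.
  by case: st4 => _ [h1 h2] _ _ _; split; apply: holds_set_agree ag5 _.
have [mX5 mY5 al5 alX5 alY5] := cert5.
have aug : augmenting C c X Y (alpha s5) th5 (typ s5) n b r.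
  have bX : b \notin X :\: Y by move: bY; rewrite !inE => /andP[/negPf-> _]; rewrite andbF.
  case: r tr sh lX intr ur ltr => [|u r] tr sh lX intr ur ltr.
    by rewrite (negPf bX) in lX.
  split=> //; first by split=> // e eY _; apply: alY5.
  (* An inner node of the path is no source, as only the last node is, and no sink, as it precedes
     the first sink in [q]; hence it lies in both trees or in neither. *)
  split=> // e er el; have eX : e \notin X :\: Y.
    by apply: contra el => eX; rewrite (intr e) // inE er orbT.
  have := lt5 e (ltr e er); move: eX; rewrite !inE.
  by case: (e \in X); case: (e \in Y).
apply: (backtrace_runs (s := s6) (X := X) (Y := Y) (th := th5) (n := n) (v := b) (r := r) (M := M)) => //.
- have := card_uniqP ur; have := max_card (mem (b :: r)); rewrite card_ord => h e.
  by apply: leq_trans h; rewrite e /=.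
- by rewrite s6E.
- by rewrite s6E.
- by rewrite s6E.
- by rewrite s6E.
- by rewrite s6E.
move=> s7 X' Y' ag7 sX7 sY7 cert7 card7; apply: (post s7 X' Y' th5) => //.
apply: agree_trans ags4 _.
have ag6 : agree (20%N :: L) [:: 2; 3; 4]%N s4 s6.
  by rewrite s6E; apply: agree_seti => //; apply: agree_sub ag5 => //; apply/allP.
apply: (agree_trans (agree_sub _ _ ag6) (agree_sub _ _ ag7)) => //; by apply/allP.
Qed.

End Phase.

(** * Initial trees and the main loop *)

Definition load_weight w := RSet 5 (getv 9) (RGet w (getv 9)).
Definition mst w A :=
  Seq (For 9 1 (load_weight w)) (Seq grow (For 9 1 (ISet A (getv 9) (IGet 7 (getv 9))))).
Definition mstK := (ctime (load_weight 0) + growK + 100)%N.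

Definition base_node :=
  Seq (ISet 12 (getv 9) (getv 22)) (setv 22 (IAdd (getv 22) (IGet 0 (INum 1)))).
Definition count_node := If (BAnd (inside 4 (getv 9)) (BNot (inside 3 (getv 9))))
  (setv 19 (succe (getv 19))) Skip.
Definition main_guard := Lt (IGet 0 (INum 2)) (getv 19).
Definition main_step := Seq phase (setv 19 (pred1e (getv 19))).
Definition rec_st :=
  Seq (For 9 1 (ISet 6 (getv 9) (INum 1)))
 (Seq (mst 0 3) (Seq (mst 1 4) (Seq (For 9 1 base_node)
 (Seq (For 9 1 count_node) (While main_guard main_step))))).
Definition rec_stK := (mstK + mstK + ctime base_node + ctime count_node +
  btime main_guard + btime main_guard + phaseK + 200)%N.

Section Main.

Variables (R : realFieldType) (G : graph) (C c : 'I_(ne G) -> R).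
Local Notation E := 'I_(ne G).
Implicit Types (s : state R) (X Y : {set E}).
Hypothesis cG : connected_graph G.

Lemma mst_runs s w A M Q T : (w, A) \in [:: (0, 3); (1, 4)]%N ->
  has_graph G s -> (ne G <= M)%N -> (0 < M)%N ->
  holds_set s 6 [set: E] -> imem s 21 0 = 0%N ->
  (forall s' F, agree [:: A; 5; 7; 8; 9; 10]%N [:: 5]%N s s' ->
     holds_set s' A F -> min_tree (fun e : E => rmem s w e) F -> (#|F| < nv G)%N -> Q s') ->
  (mstK * (nv G * M) <= T)%N ->
  runs (mst w A) s T Q.
Proof.
move=> wA hg mM M0 sA x21 post le_T; have n0 := proj1 cG.
have wA' : (w = 0 /\ A = 3)%N \/ (w = 1 /\ A = 4)%N.
  by move: wA; rewrite !inE => /orP[] /eqP[-> ->]; [left|right].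
have : runs (mst w A) s (M * (ctime (load_weight 0) + 23) + (growK * (nv G * M) + M * (3 + 27))) Q; last first.
  move=> h; apply: runs_weaken h _ (fun _ h => h); apply: leq_trans le_T.
  have h1 : (M <= nv G * M)%N by apply: leq_pmull.
  rewrite /mstK; move: growK (ctime _) => a b.
  have h3 := leq_mul h1 (leqnn (b + 53)); lia.
apply: runs_seq; apply: (runs_for (N := ne G) (M := M) (tb := ctime (load_weight 0)) (I := fun i s' =>
  agree [:: 9]%N [:: 5]%N s s' /\ forall e : E, (e < i)%N -> rmem s' 5 e = rmem s w e)) => //.
- by move=> i s' v [ag h]; split; first exact: agree_seti.
- by move=> i s' [ag _]; rewrite (proj1 ag) //; case: hg.
- move=> i s1 lt x9 [ag h]; apply: runs_straight => //=; split=> //.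
  split; first exact: agree_setr.
  move=> e; rewrite ltnS leq_eqVlt updE x9 eqxx /= => /orP[/eqP->|lte].
    by rewrite eqxx (proj2 ag) //; case: wA' => -[-> _].
  by rewrite ltn_eqF // h.
move=> s1 [ag1 w1].
have hg1 : has_graph G s1 by apply: has_graph_agree ag1 hg.
apply: runs_seq; apply: (grow_runs (A := [set: E]) (x0 := Ordinal n0) (M := M)) => //.
- exact: holds_set_agree ag1 sA.
- by rewrite (proj1 ag1).
move=> s2 V F ag2 pr _ sF2.
have hg2 : has_graph G s2 by apply: has_graph_agree ag2 hg1.
apply: (runs_fill (N := ne G) (M := M) (f := fun i => imem s2 7 i)) => //.
- by case: hg2.
- by case: wA' => -[_ ->].
- by case: wA' => -[_ ->].
- by move=> s' i _ ag /= ->; rewrite (proj1 ag) //; case: wA' => -[_ ->].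
move=> s3 ag3 s3F; have [mF cF] := prim_min_tree pr cG erefl.
apply: (post s3 F) => //.
- apply: agree_trans (agree_trans (agree_sub _ _ ag1) (agree_sub _ _ ag2)) (agree_sub _ _ ag3) => // z;
  rewrite !inE //; first by move=> ->; rewrite ?orbT.
  + by move=> ->; rewrite orbT.
  + by move=> /orP[] ->; rewrite ?orbT.
- by move=> e; rewrite s3F.
rewrite (_ : (fun e : E => rmem s w e) = (fun e : E => rmem s1 5 e)) //.
by apply: functional_extensionality => e; rewrite w1.
Qed.

Lemma base_runs s M Q T :
  has_graph G s -> (ne G <= M)%N -> (0 < M)%N -> imem s 22 0 = 0%N ->
  (forall s', agree [:: 9; 12; 22]%N [::] s s' -> holds_base G s' -> Q s') ->
  (M * (ctime base_node + 23) <= T)%N ->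
  runs (For 9 1 base_node) s T Q.
Proof.
move=> hg mM M0 x22 post le_T; have [_ gm _ _] := hg.
apply: (runs_for (N := ne G) (M := M) (tb := ctime base_node) (I := fun i s' =>
  [/\ agree [:: 9; 12; 22]%N [::] s s', imem s' 22 0 = (i * ne G)%N &
      forall e, (e < i)%N -> imem s' 12 e = (e * ne G)%N])) => //.
- by move=> i s' v [ag h1 h2]; split=> //; first exact: agree_seti.
- by move=> i s' [ag _ _]; rewrite (proj1 ag).
- move=> i s1 lt x9 [ag h1 h2]; apply: runs_straight => //=.
  rewrite !updE /= x9 h1 (proj1 ag) // gm; split=> //; split.
  + by do 2!apply: agree_seti => //.
  + by rewrite /= ?updE /= mulSn addnC.
  + move=> e; rewrite /= ?updE /= ltnS leq_eqVlt.
    by case: eqP => [->|_] //=; apply: h2.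
- by move=> s' [ag _ h]; apply: post => // u; apply: h.
Qed.

Lemma count_runs s X Y M Q T :
  has_graph G s -> (ne G <= M)%N -> (0 < M)%N -> imem s 19 0 = 0%N ->
  holds_set s 3 X -> holds_set s 4 Y ->
  (forall s', agree [:: 9; 19]%N [::] s s' -> imem s' 19 0 = #|Y :\: X| -> Q s') ->
  (M * (ctime count_node + 23) <= T)%N ->
  runs (For 9 1 count_node) s T Q.
Proof.
move=> hg mM M0 x19 sX sY post le_T; have [_ gm _ _] := hg.
apply: (runs_for (N := ne G) (M := M) (tb := ctime count_node) (I := fun i s' =>
  agree [:: 9; 19]%N [::] s s' /\ imem s' 19 0 = #|[set e in Y :\: X | (e < i)%N]|)) => //.
- by split=> //; rewrite x19 -[LHS](@cards0 E); apply: eq_card => e; rewrite !inE andbF.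
- by move=> i s' v [ag h]; split=> //; first exact: agree_seti.
- by move=> i s' [ag _]; rewrite (proj1 ag).
- move=> i s1 lt x9 [ag h]; apply: runs_straight => //.
  have [v vi] : {v : E | val v = i} by exists (Ordinal lt).
  have x9v : imem s1 9 0 = v by rewrite vi.
  rewrite /count_node run_if.
  have -> : beval s1 (BAnd (inside 4 (getv 9)) (BNot (inside 3 (getv 9)))) = (v \in Y :\: X).
    by rewrite /= x9v !(proj1 ag) // sX sY !lt0b inE andbC.
  have ltS (w : E) : (w < i.+1)%N = (w == v) || (w < i)%N.
    by rewrite ltnS leq_eqVlt -val_eqE vi.
  case: ifPn => vY /=; rewrite ?updE /=; split=> //; split=> //.
  + exact: agree_seti.
  + rewrite ?updE /= ?updE /= h addn1.
    rewrite (_ : [set e in Y :\: X | (e < i.+1)%N] = v |: [set e in Y :\: X | (e < i)%N]).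
      by rewrite cardsU1 inE -vi ltnn andbF.
    apply/setP => e; rewrite in_setU1 !(inE, ltS).
    by case: (eqVneq e v) => [->|] //=; move: vY; rewrite inE => ->.
  rewrite h; apply: eq_card => e; rewrite !(inE, ltS).
  by case: (eqVneq e v) => [->|] //=; move: vY; rewrite inE => /negPf->.
- move=> s' [ag h]; apply: post => //; rewrite h; apply: eq_card => e.
  by rewrite !inE ltn_ord andbT.
Qed.

Lemma holds_set_output s a (A : {set E}) : holds_set s a A -> output G s a = A.
Proof. by move=> sA; apply/setP => e; rewrite inE sA eqb0 negbK. Qed.

Lemma input_graph k : has_graph G (input C c k).
Proof. by split=> //= e; rewrite /table valK. Qed.

(** The factors are bounded below by 1 because the preparation takes time even if no phase is run or
    the graph has no edge. *)
Lemma rec_st_runs k : (k <= nv G - 1)%N ->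
  runs rec_st (input C c k)
    (rec_stK * (maxn 1 (nv G - 1 - k) * maxn 1 (ne G) ^ 2 * nv G))%N
    (fun s => rec_st_solution C c k (output_X G s) (output_Y G s)).
Proof.
move=> kn; set M := maxn 1 (ne G); set L := maxn 1 _; set s0 := input C c k.
have mM : (ne G <= M)%N by apply: leq_maxr.
have M0 : (0 < M)%N by rewrite /M leq_max.
have n0 := proj1 cG.
set P := (M * (nv G * M))%N.
have hg0 : has_graph G s0 := input_graph k.
have : runs rec_st s0 (M * (1 + 27) + (mstK * (nv G * M) + (mstK * (nv G * M) +
   (M * (ctime base_node + 23) + (M * (ctime count_node + 23) +
    ((nv G - 1 - k) * (btime main_guard + (phaseK * P + 7)).+1 + (btime main_guard).+1)))))) 
   (fun s => rec_st_solution C c k (output_X G s) (output_Y G s)); last first.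
  move=> h; apply: runs_weaken h _ (fun _ h => h).
  have PE : (L * M ^ 2 * nv G = L * P)%N by rewrite /P; lia.
  rewrite PE.
  have L1 : (0 < L)%N by rewrite /L leq_max.
  have LL : (nv G - 1 - k <= L)%N by rewrite /L leq_maxr.
  have h1 : (M <= P)%N by apply: leq_pmulr; rewrite muln_gt0 n0.
  have h2 : (nv G * M <= P)%N by apply: leq_pmull.
  have h3 : (P <= L * P)%N by apply: leq_pmull.
  rewrite /rec_stK; move: mstK (ctime base_node) (ctime count_node) (btime main_guard) phaseK.
  move: (nv G * M)%N (nv G - 1 - k)%N P LL h1 h2 h3 {PE} => Q l P LL h1 h2 h3 a b d e f.
  have g1 := leq_mul (leq_trans h2 h3) (leqnn a).
  have g2 := leq_mul (leq_trans h1 h3) (leqnn (b + d + 74)).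
  have P0 : (0 < P)%N by apply: leq_trans h1.
  have g3 : (l * (e + (f * P + 7)).+1 <= L * P * (e + f + 8))%N.
    rewrite -mulnA; apply: leq_mul => //.
    have := leq_pmull (e + 8) P0; lia.
  have g4 : (e.+1 <= L * P * e.+1)%N by apply: leq_pmull; rewrite muln_gt0 L1.
  lia.
apply: runs_seq; apply: (runs_fill (N := ne G) (M := M) (f := fun=> 1%N)) => //.
move=> s1 ag1 s1A.
have hg1 : has_graph G s1 by apply: has_graph_agree ag1 hg0.
apply: runs_seq; apply: (mst_runs (M := M)) => //.
- by move=> e; rewrite s1A // inE.
- by rewrite (proj1 ag1).
move=> s2 X ag2 sX mX cX.
have hg2 : has_graph G s2 by apply: has_graph_agree ag2 hg1.
apply: runs_seq; apply: (mst_runs (M := M)) => //.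
- by move=> e; rewrite (proj1 ag2) // s1A // inE.
- by rewrite (proj1 ag2) // (proj1 ag1).
move=> s3 Y ag3 sY mY cY.
have hg3 : has_graph G s3 by apply: has_graph_agree ag3 hg2.
apply: runs_seq; apply: (base_runs (M := M)) => //.
  by rewrite (proj1 ag3) // (proj1 ag2) // (proj1 ag1).
move=> s4 ag4 sb4.
have hg4 : has_graph G s4 by apply: has_graph_agree ag4 hg3.
apply: runs_seq; apply: (count_runs (X := X) (Y := Y) (M := M)) => //.
- by rewrite (proj1 ag4) // (proj1 ag3) // (proj1 ag2) // (proj1 ag1).
- by apply: holds_set_agree ag4 _ => //; apply: holds_set_agree ag3 _.
- by apply: holds_set_agree ag4 _.
move=> s5 ag5 x5.
have ags5 : agree [:: 3; 4; 5; 6; 7; 8; 9; 10; 12; 19; 22]%N [:: 5]%N s0 s5.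
  apply: agree_trans (agree_sub _ _ ag1) (agree_trans (agree_sub _ _ ag2)
    (agree_trans (agree_sub _ _ ag3) (agree_trans (agree_sub _ _ ag4) (agree_sub _ _ ag5)))) => //;
  by apply/allP.
have C0 (e : E) : rmem s0 0 e = C e by rewrite /= /table valK.
have c0 (e : E) : rmem s0 1 e = c e by rewrite /= /table valK.
(* Real array 2 is zero in the input and still untouched, so the two initial trees are certified
   with [th = 0]. *)
have al5 (e : E) : alpha s5 e = 0 by rewrite /alpha (proj2 ags5).
have sX5 : holds_set s5 3 X.
  apply: holds_set_agree ag5 _ => //; apply: holds_set_agree ag4 _ => //.
  exact: holds_set_agree ag3 _.
have sY5 : holds_set s5 4 Y.
  by apply: holds_set_agree ag5 _ => //; apply: holds_set_agree ag4 _.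
(* Only a phase can make [th] nonzero, and it runs only while the difference exceeds [k]; so on exit
   one of the two optimality conditions of the certificate holds. *)
pose I j s := exists X Y th, [/\ problem C c s X Y, certificate C c X Y (alpha s) th,
  imem s 0 2 = k /\ imem s 19 0 = #|Y :\: X|, j = (#|Y :\: X| - k)%N &
  th = 0 \/ (k <= #|Y :\: X|)%N].
have I5 : I (#|Y :\: X| - k)%N s5.
  exists X, Y, 0; split=> //; last by left.
  - split=> //.
    + exact: has_graph_agree ag5 hg4.
    + by move=> u; rewrite (proj1 ag5).
    + by split=> e; rewrite (proj2 ags5).
  - split=> // [||e]; last by rewrite al5 lexx.
      rewrite (_ : redX C (alpha s5) = fun e : E => rmem s1 0 e) //.
      by apply: functional_extensionality => e; rewrite /redX al5 subr0 (proj2 ag1) ?C0.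
    rewrite (_ : redY c (alpha s5) = fun e : E => rmem s2 1 e) //.
    apply: functional_extensionality => e.
    by rewrite /redY al5 addr0 (proj2 ag2) // (proj2 ag1) // c0.
  - by rewrite (proj1 ags5).
apply: (@runs_while _ _ _ s5 I (#|Y :\: X| - k)%N (phaseK * P + 7)%N) => //.
- move=> j s6 [X6 [Y6 [th6 [pb6 cert6 [xk xc] -> th_k]]]].
  rewrite /= xk xc -ltnNge => lt; split; first by rewrite subn_gt0.
  have [n nE] : {n | #|Y6 :\: X6| = n.+1} by exists #|Y6 :\: X6|.-1; rewrite (ltn_predK lt).
  apply: runs_seq; apply: (phase_runs (M := M) pb6 mM M0 n0 cert6 nE) => //.
  move=> s7 X7 Y7 th7 ag7 sX7 sY7 cert7 n7.
  apply: runs_straight => //=; rewrite (proj1 ag7) // xc nE subn1 /=.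
  exists (n - k)%N; first by lia.
  exists X7, Y7, th7; split=> //.
  + case: pb6 => hg6 _ sb6 [h1 h2]; split=> //.
    * by apply: (has_graph_agree _ _ _ ag7) hg6.
    * by move=> u; have := sb6 u; rewrite -(proj1 ag7).
    * by split=> e; rewrite /= (proj2 ag7).
  + by rewrite /= n7 !updE /= (proj1 ag7).
  + by rewrite n7.
  + by right; rewrite n7; lia.
- move=> j s6 [X6 [Y6 [th6 [[_ [sX6 sY6] _ _] cert6 [xk xc] _ th_k]]]].
  rewrite /= xk xc negbK => le.
  rewrite /output_X /output_Y (holds_set_output sX6) (holds_set_output sY6).
  exact: certificate_solution cert6 le th_k.
rewrite leq_add2r leq_mul2r; apply/orP; right.
have : (#|Y :\: X| <= #|Y|)%N by apply/subset_leq_card/subsetDl.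
lia.
Qed.

End Main.

Local Close Scope ring_scope.

Theorem theorem3 :
  exists (P : cmd) (K : nat),
    forall (R : realFieldType) (G : graph) (C c : 'I_(ne G) -> R) (k : nat),
      let n := nv G in
      let m := ne G in
      let L := n - 1 - k in
      connected_graph G ->
      k <= n - 1 ->
      exists (t : nat) (s : state R),
        [/\ exec P (input C c k) t s,
            rec_st_solution C c k (output_X G s) (output_Y G s)
          & t <= K * (maxn 1 L * maxn 1 m ^ 2 * n)].
Proof.
exists rec_st, rec_stK => R G C c k n m L cG kn.
by have [t [s [ex le sol]]] := rec_st_runs C c cG kn; exists t, s.
Qed.
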